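(* Let $G$ be a connected Lie group and $\varphi=\{\varphi_t\}_{t\in\mathbb{R}}$ a flow of automorphisms on $G$. Then $G^+$ and $G^-$ are, respectively, the unstable and stable manifolds of $\varphi$ at the identity element $e$, that is, $$G^-=\{g\in G:\varphi_t(g)\to e \text{ as } t\to+\infty\}\quad\text{and}\quad G^+=\{g\in G:\varphi_t(g)\to e\text{ as } t\to-\infty\}.$$
   Context: A flow of automorphisms on $G$ is a (smooth) one-parameter group $\{\varphi_t\}_{t\in\mathbb{R}}$ of automorphisms of $G$. With $\mathfrak{g}$ the Lie algebra of $G$ (identified with the right-invariant vector fields), there is an associated derivation $\mathcal{D}$ of $\mathfrak{g}$ with $(d\varphi_t)_e=\mathrm{e}^{t\mathcal{D}}$ for all $t\in\mathbb{R}$. A linear map on a finite-dimensional real vector space is semisimple if its complexification is diagonalizable; it is elliptic (resp. hyperbolic) if it is semisimple with all eigenvalues purely imaginary, $0$ allowed (resp. real). Write $\mathcal{D}=\mathcal{D}_{\mathcal{E}}+\mathcal{D}_{\mathcal{H}}+\mathcal{D}_{\mathcal{N}}$ for the unique (Jordan) decomposition into commuting elliptic, hyperbolic and nilpotent parts; all three are derivations. Let $\mathfrak{g}^+$ (resp. $\mathfrak{g}^-$) be the sum of the eigenspaces of $\mathcal{D}_{\mathcal{H}}$ with positive (resp. negative) eigenvalues; these are nilpotent Lie subalgebras. Set $G^+=\exp(\mathfrak{g}^+)$ and $G^-=\exp(\mathfrak{g}^-)$ (these are subgroups of $G$). *)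

(* Defs.v *)
From HB Require Import structures.
From mathcomp Require Import all_boot all_order all_algebra complex.
From mathcomp Require Import all_classical all_reals all_analysis.

Set Implicit Arguments.
Unset Strict Implicit.
Unset Printing Implicit Defensive.

Import Order.TTheory GRing.Theory Num.Theory.
Import numFieldNormedType.Exports.

Local Open Scope classical_set_scope.
Local Open Scope ring_scope.

(* [f] is C^k on the open set [U]: all iterated directional derivatives of
   order at most k exist and are continuous at every point of [U].  In finite
   dimension this is the usual notion of C^k map. *)
Fixpoint Cn_on (R : realType) (V W : normedModType R) (k : nat)
    (U : set V) (f : V -> W) : Prop :=
  (forall x, U x -> {for x, continuous f}) /\
  if k is k'.+1 then
    forall v : V, (forall x, U x -> derivable f x v) /\
                  Cn_on k' U (fun x => 'D_v f x)
  else True.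

Definition smooth_on (R : realType) (V W : normedModType R)
    (U : set V) (f : V -> W) : Prop := forall k, Cn_on k U f.

(* [cinv] is only meaningful on the image of [cdom] under [cmap]. *)
Record chart (R : realType) (M : topologicalType) (E : normedModType R) :=
  Chart { cdom : set M ; cmap : M -> E ; cinv : E -> M }.

Definition cimg (R : realType) (M : topologicalType) (E : normedModType R)
    (c : chart M E) : set E := cmap c @` cdom c.

Definition is_chart (R : realType) (M : topologicalType) (E : normedModType R)
    (c : chart M E) : Prop :=
  [/\ open (cdom c),
      open (cimg c),
      forall x, cdom c x -> cinv c (cmap c x) = x,
      forall x, cdom c x -> {for x, continuous (cmap c)} &
      forall y, cimg c y -> {for y, continuous (cinv c)}].

Definition smooth_atlas (R : realType) (M : topologicalType)
    (E : normedModType R) (A : set (chart M E)) : Prop :=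
  [/\ forall c, A c -> is_chart c,
      forall x, exists2 c, A c & cdom c x &
      forall c d, A c -> A d ->
        smooth_on (cmap c @` (cdom c `&` cdom d)) (cmap d \o cinv c)].

Definition id_atlas (R : realType) (E : normedModType R) : set (chart E E) :=
  [set Chart setT id id].

Definition prod_chart (R : realType) (M N : topologicalType)
    (E F : normedModType R) (c : chart M E) (d : chart N F) :
    chart (M * N)%type (E * F)%type :=
  Chart (cdom c `*` cdom d)
        (fun p => (cmap c p.1, cmap d p.2))
        (fun q => (cinv c q.1, cinv d q.2)).

Definition prod_atlas (R : realType) (M N : topologicalType)
    (E F : normedModType R) (A : set (chart M E)) (B : set (chart N F)) :
    set (chart (M * N)%type (E * F)%type) :=
  [set e | exists c d, [/\ A c, B d & e = prod_chart c d]].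

Definition smooth_map (R : realType) (M N : topologicalType)
    (E F : normedModType R) (A : set (chart M E)) (B : set (chart N F))
    (f : M -> N) : Prop :=
  continuous f /\
  forall c d, A c -> B d ->
    smooth_on (cmap c @` (cdom c `&` f @^-1` cdom d))
              (cmap d \o f \o cinv c).

HB.mixin Record isLieGroup (R : realType) (n : nat) G
    of Topological G & Group G := {
  lie_atlas : set (chart G 'rV[R]_n) ;
  lie_atlasP : smooth_atlas lie_atlas ;
  lie_hausdorff : hausdorff_space G ;
  lie_second_countable : @second_countable G ;
  lie_mul_smooth : smooth_map (prod_atlas lie_atlas lie_atlas) lie_atlas
                     (fun p : G * G => (p.1 * p.2)%g) ;
  lie_inv_smooth : smooth_map lie_atlas lie_atlas (fun x : G => x^-1%g)
}.

#[short(type="lieGroupType")]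
HB.structure Definition LieGroup (R : realType) (n : nat) :=
  {G of Topological G & Group G & isLieGroup R n G}.

(* In this section [c] stands for a chart around the identity e.  Its
   differential at e identifies T_e G, that is, the space of right-invariant
   vector fields (through evaluation at e), with ['rV[R]_n].  Endomorphisms
   are matrices acting on row vectors on the right, X |-> X *m D. *)
Section LieAlgebra.
Context {R : realType} {n : nat} {G : lieGroupType R n}.
Implicit Types (c : chart G 'rV[R]_n) (X Y : 'rV[R]_n) (D : 'M[R]_n).

Definition chart_at_identity c : Prop := lie_atlas c /\ cdom c 1%g.

(* Differential at e of a map fixing e. *)
Definition diff_at_identity c (f : G -> G) (X : 'rV[R]_n) : 'rV[R]_n :=
  'D_X (cmap c \o f \o cinv c) (cmap c 1%g).

(* Coordinate expression, on the image of [c], of the right-invariant vector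
   field g |-> d(R_g)_e X, where R_g h = h * g. *)
Definition right_invariant_field c X (x : 'rV[R]_n) : 'rV[R]_n :=
  'D_X (fun y => cmap c (cinv c y * cinv c x)%g) (cmap c 1%g).

(* Value at e of the bracket of the right-invariant fields of X and Y; in
   coordinates the bracket of the fields v and w is dw(v) - dv(w). *)
Definition lie_bracket c X Y : 'rV[R]_n :=
  'D_X (right_invariant_field c Y) (cmap c 1%g) -
  'D_Y (right_invariant_field c X) (cmap c 1%g).

Definition is_derivation c D : Prop :=
  forall X Y, lie_bracket c X Y *m D =
              lie_bracket c (X *m D) Y + lie_bracket c X (Y *m D).

Definition one_parameter_subgroup (gamma : R -> G) : Prop :=
  smooth_map (@id_atlas R R) lie_atlas gamma /\
  forall s t, gamma (s + t) = (gamma s * gamma t)%g.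

(* exp X = gamma 1 for the one-parameter subgroup gamma with gamma'(0) = X;
   the default value 1 is never used, since gamma always exists. *)
Definition lie_exp c X : G :=
  xget 1%g [set g | exists gamma, [/\ one_parameter_subgroup gamma,
                      'D_1 (cmap c \o gamma) 0 = X & g = gamma 1]].

End LieAlgebra.

Section LinearAlgebra.
Context {R : realType} {n : nat}.
Implicit Types (D E H N : 'M[R]_n).

Definition expmx D : 'M[R]_n :=
  limn (series (fun k : nat => (k`!%:R : R)^-1 *: D ^+ k)).

Definition complexify D : 'M[R[i]]_n := map_mx (real_complex R) D.

Definition semisimple D : Prop := diagonalizable (complexify D).

Definition elliptic D : Prop :=
  semisimple D /\
  forall z : R[i], eigenvalue (complexify D) z -> complex.Re z = 0.

Definition hyperbolic D : Prop :=
  semisimple D /\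
  forall z : R[i], eigenvalue (complexify D) z -> complex.Im z = 0.

Definition nilpotent_mx D : Prop := exists k : nat, D ^+ k = 0.

Definition jordan_decomposition D E H N : Prop :=
  [/\ D = E + H + N,
      [/\ elliptic E, hyperbolic H & nilpotent_mx N] &
      [/\ comm_mx E H, comm_mx E N & comm_mx H N]].

(* Sums of the eigenspaces of positive (resp. negative) eigenvalues;
   [eigenspace H a] is the null space when [a] is not an eigenvalue. *)
Definition pos_eigensum H : set 'rV[R]_n :=
  [set X | exists s : seq R, all (fun a => 0 < a) s /\
                             (X <= \sum_(a <- s) eigenspace H a)%MS].

Definition neg_eigensum H : set 'rV[R]_n :=
  [set X | exists s : seq R, all (fun a => a < 0) s /\
                             (X <= \sum_(a <- s) eigenspace H a)%MS].

End LinearAlgebra.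

Section Flow.
Context {R : realType} {n : nat} {G : lieGroupType R n}.
Implicit Types (phi : R -> G -> G) (c : chart G 'rV[R]_n) (D H : 'M[R]_n).

(* Each [phi t] is bijective, with inverse [phi (- t)], and smooth in both
   directions, hence an automorphism of the Lie group. *)
Definition flow_of_automorphisms phi : Prop :=
  [/\ smooth_map (prod_atlas (@id_atlas R R) lie_atlas) lie_atlas
        (fun p : R * G => phi p.1 p.2),
      forall g, phi 0 g = g,
      forall s t g, phi (s + t) g = phi s (phi t g) &
      forall t g h, phi t (g * h)%g = (phi t g * phi t h)%g].

Definition associated_derivation phi c D : Prop :=
  is_derivation c D /\
  forall t X, diff_at_identity c (phi t) X = X *m expmx (t *: D).

(* G^+ and G^-; [H] is the hyperbolic part of the associated derivation. *)
Definition Gplus c H : set G := lie_exp c @` pos_eigensum H.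
Definition Gminus c H : set G := lie_exp c @` neg_eigensum H.

Definition stable_manifold phi : set G :=
  [set g | phi t g @[t --> +oo] --> (1%g : G)].

Definition unstable_manifold phi : set G :=
  [set g | phi t g @[t --> -oo] --> (1%g : G)].

End Flow.

(* Main.v *)
Require Import Defs.
From HB Require Import structures.
From mathcomp Require Import all_boot all_order all_algebra complex.
From mathcomp Require Import all_classical all_reals all_analysis.
From mathcomp Require Import ring lra.
Import Order.TTheory GRing.Theory Num.Theory.
Import numFieldNormedType.Exports.
Local Open Scope classical_set_scope.
Local Open Scope ring_scope.

Set Implicit Arguments.
Unset Strict Implicit.
Unset Printing Implicit Defensive.

(* Since [phi t] is an automorphism with differential [e^{tD}], it maps the
   one-parameter subgroup with velocity [X] to the one with velocity
   [X e^{tD}].  Near the identity exp is a bijection onto a neighbourhood, so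
   [phi t (exp X)] tends to e as soon as [X e^{tD}] tends to 0.  Conversely, if
   [phi t g] tends to e, then for all large [t] it has a small logarithm [X t];
   by uniqueness of small logarithms, [X (t + s) = X t e^{sD}] for small
   [s >= 0], hence for all [s >= 0], and pulling back by [phi (- t)] gives
   [g = exp X] with [X e^{tD}] tending to 0.  By the Jordan decomposition this
   happens exactly for [X] in the sum of the eigenspaces of [DH] with negative
   eigenvalues.
   The unstable case is the stable case for [t |-> phi (- t)] and [- D].

   The exponential map of the Lie group, which is needed near 0 only, is
   obtained without differential equations, as the limit of
   [(X / N) ^ N] computed in a chart centered at e. *)

(** * Differential calculus on row vectors *)

(** In a chart centered at e the product is [x + y] up to an error that is Lipschitz in each
    variable, with a constant proportional to the norm of the other; this comes from a bound on the
    mixed second derivatives. It makes [(X / N) ^ N] a Cauchy sequence and turns exp into the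
    identity plus a map of Lipschitz constant 1/2, which gives injectivity and, by iteration,
    surjectivity near 0. Identities for exp are then first-order computations: when [g_k] tends to
    e, the limit of [g_k ^ j_k] depends only on the limit of [j_k] times the coordinates of [g_k].
    The definition of exp asks for smooth one-parameter subgroups, whereas the limit provides a
    homomorphism known to be differentiable at 0 only. Translation on the right makes it an integral
    curve of a smooth field in every chart, and its regularity is bootstrapped from that
    equation. *)

Lemma is_derive_epsP (R : realType) (V W : normedModType R) (f : V -> W)
    (a v : V) (l : W) :
  is_derive a v f l <-> forall e, 0 < e ->
    \forall h \near (0 : R), `|f (h *: v + a) - f a - h *: l| <= e * `|h|.
Proof.
split=> [[/cvg_ex[l' fl'] <-] e e0|H].
  have fl : h^-1 *: (f (h *: v + a) - f a) @[h --> 0^'] --> 'D_v f a.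
    by rewrite /derive (cvg_lim _ fl').
  move/cvgrPdist_le : fl => /(_ _ e0); rewrite near_withinE; apply: filterS => h H.
  (* At [h = 0] both sides vanish, which turns the punctured neighbourhood into a full one. *)
  have [->|h0] := eqVneq h 0.
    by rewrite !scale0r add0r subrr subr0 !normr0 mulr0.
  rewrite -[X in `|X - _|]scale1r -(mulfV h0) -scalerA -scalerBr normrZ distrC.
  by rewrite mulrC ler_wpM2r //; exact: H.
have fl : h^-1 *: (f (h *: v + a) - f a) @[h --> 0^'] --> l.
  apply/cvgrPdist_le => e e0; rewrite near_withinE.
  apply: filterS (H _ e0) => h + h0.
  rewrite -[X in `|X - _|]scale1r -(mulfV h0) -scalerA -scalerBr normrZ distrC.
  by rewrite mulrC ler_pM2r// normr_gt0.
by split; [apply/cvg_ex; exists l|exact/cvg_lim].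
Qed.

Lemma is_derive_scale_dir (R : realType) (V W : normedModType R) (f : V -> W)
    (a v : V) (k : R) (l : W) :
  is_derive a v f l -> is_derive a (k *: v) f (k *: l).
Proof.
move=> /is_derive_epsP H; apply/is_derive_epsP => e e0.
(* [|k| + 1] instead of [|k|], so that [k = 0] is no exception. *)
have k1 : 0 < `|k| + 1 by rewrite ltr_wpDl.
have ek : 0 < e / (`|k| + 1) by rewrite divr_gt0.
have : \forall h \near (0 : R), `|f ((h * k) *: v + a) - f a - (h * k) *: l|
    <= e / (`|k| + 1) * `|h * k|.
  have : (h * k) @[h --> (0 : R)] --> (0 : R).
    by rewrite -[X in _ --> X](mul0r k); apply: cvgMl; exact: cvg_id.
  by move=> /(_ _ (H _ ek)).
apply: filterS => h; rewrite !scalerA => /le_trans; apply.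
rewrite normrM [_ * `|k|]mulrC mulrA ler_wpM2r// -mulrA ler_piMr// ?ltW//.
by rewrite mulrC ltr_pdivrMr// mul1r ltrDl.
Qed.

Lemma derivable_scale_dir (R : realType) (V W : normedModType R) (f : V -> W)
    (a v : V) (k : R) : derivable f a v -> derivable f a (k *: v).
Proof. by move=> /derivableP /(is_derive_scale_dir k)[]. Qed.

Lemma derive_scale_dir (R : realType) (V W : normedModType R) (f : V -> W)
    (a v : V) (k : R) : derivable f a v -> 'D_(k *: v) f a = k *: 'D_v f a.
Proof. by move=> /derivableP /(is_derive_scale_dir k)[]. Qed.

Lemma is_diff_epsP (R : realType) (V W : normedModType R) (f : V -> W)
    (x : V) (df : {linear V -> W}) : continuous df ->
  (forall e, 0 < e ->
    \forall h \near (0 : V), `|f (h + x) - f x - df h| <= e * `|h|) ->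
  is_diff x f df.
Proof.
move=> cdf H.
have E : f \o shift x = cst (f x) + df +o_ 0 id.
  apply/eqaddoP => e e0; apply: filterS (H _ e0) => h /=.
  rewrite -addrA opprD !fctE /= addrA.
  by rewrite [X in X - _]addrC.
have d := diff_unique cdf E.
by split => //; apply/diff_locallyP; rewrite d.
Qed.

Section Segment.
Context {R : realType} {V : normedModType R}.

Lemma is_derive_segment (W : normedModType R) (f : V -> W) (x h : V) (t : R) :
  derivable f (t *: h + x) h ->
  is_derive t 1 (fun s => f (s *: h + x)) ('D_h f (t *: h + x)).
Proof.
move=> /derivableP /is_derive_epsP H; apply/is_derive_epsP => e e0.
apply: filterS (H _ e0) => s /=.
by rewrite scalerDl addrA /= [s *: (1 : R)]mulr1.
Qed.

Lemma mean_value_segment (f : V -> R) (x h : V) :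
  (forall t, 0 <= t <= 1 -> derivable f (t *: h + x) h) ->
  exists2 t, 0 <= t <= 1 & f (h + x) - f x = 'D_h f (t *: h + x).
Proof.
move=> H.
have [||t t01 E] := @MVT_segment R (fun s => f (s *: h + x))
  (fun s => 'D_h f (s *: h + x)) 0 1 ler01.
- move=> t; rewrite in_itv/= => /andP[t0 t1]; apply: is_derive_segment.
  by apply: H; rewrite !ltW.
- apply: derivable_within_continuous => t; rewrite in_itv /= => t01.
  by have [] := is_derive_segment (H t t01).
- by exists t => //; move: E; rewrite subr0 mulr1 scale1r scale0r add0r.
Qed.

End Segment.

Section RowNorm.
Context {R : realType}.

Lemma coord_norm_le n (x : 'rV[R]_n) i : `|x 0 i| <= `|x|.
Proof.
rewrite [leRHS]/Num.Def.normr/= mx_normrE.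
exact: (le_trans _ (le_bigmax _ _ (ord0, i))).
Qed.

Lemma rV_norm_le n (x : 'rV[R]_n) e : 0 <= e ->
  (forall i, `|x 0 i| <= e) -> `|x| <= e.
Proof.
move=> e0 H; rewrite [leLHS]/Num.Def.normr/= mx_normrE.
by apply: bigmax_le => // -[i j] _ /=; rewrite ord1.
Qed.

(** The norm is the largest absolute value of a coordinate, so the scalar mean value theorem, with a
    separate intermediate point for each coordinate, loses no constant. *)
Lemma mean_value_ineq (V : normedModType R) n (f : V -> 'rV[R]_n) (x h : V)
    (l : 'rV[R]_n) e :
  (forall t, 0 <= t <= 1 -> derivable f (t *: h + x) h) ->
  (forall t, 0 <= t <= 1 -> `|'D_h f (t *: h + x) - l| <= e) ->
  `|f (h + x) - f x - l| <= e.
Proof.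
move=> fd fl.
have e0 : 0 <= e by apply: le_trans (fl 0 _); rewrite // lexx ler01.
apply: rV_norm_le => // i.
have [t t01|t t01 E] := @mean_value_segment R V (fun y => f y 0 i) x h.
  by have /derivable_mxP := fd t t01; exact.
rewrite !mxE E.
have -> : 'D_h (fun y : V => f y 0 i) (t *: h + x) = ('D_h f (t *: h + x)) 0 i.
  by rewrite derive_mx ?mxE//; exact: fd.
apply: le_trans (fl t t01).
by apply: le_trans (coord_norm_le _ i); rewrite !mxE.
Qed.

End RowNorm.

Lemma near_norm_shiftP (R : realType) (V : normedModType R) (x : V)
    (P : V -> Prop) :
  (\forall y \near x, P y) <->
  exists2 d : R, 0 < d & forall h : V, `|h| < d -> P (h + x).
Proof.
split=> [/nbhs_ballP [d /= d0 Hd]|[d d0 Hd]].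
  exists d => // h hd; apply: Hd.
  by rewrite -ball_normE /= opprD addrC subrK normrN.
apply/nbhs_ballP; exists d => // y; rewrite -ball_normE /= distrC => /Hd.
by rewrite subrK.
Qed.

(** * Closure properties of C^k maps *)

Section CnCalculus.
Context {R : realType}.
Implicit Types V W : normedModType R.

Lemma Cn_on_continuous V W k (U : set V) (f : V -> W) :
  Cn_on k U f -> forall x, U x -> {for x, continuous f}.
Proof. by case: k => [|k] []. Qed.

Lemma Cn_onS V W k (U : set V) (f : V -> W) : Cn_on k.+1 U f -> Cn_on k U f.
Proof.
elim: k f => [|k IH] f [fc fd]; split => // v.
by have [fdv Dv] := fd v; split=> //; exact: IH.
Qed.

Lemma Cn_on_derivable V W k (U : set V) (f : V -> W) x v :
  Cn_on k.+1 U f -> U x -> derivable f x v.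
Proof. by move=> [_ /(_ v)[+ _]]; exact. Qed.

Lemma Cn_on_derive V W k (U : set V) (f : V -> W) v :
  Cn_on k.+1 U f -> Cn_on k U ('D_v f).
Proof. by move=> [_ /(_ v)[]]. Qed.

Lemma Cn_on_subset V W k (U U' : set V) (f : V -> W) :
  U' `<=` U -> Cn_on k U f -> Cn_on k U' f.
Proof.
move=> U'U; elim: k f => [|k IH] f [fc fd]; split => //.
- by move=> x /U'U; exact: fc.
- by move=> x /U'U; exact: fc.
- move=> v; have [fdv Dv] := fd v; split; last exact: IH.
  by move=> x /U'U; exact: fdv.
Qed.

Lemma Cn_on_ext V W k (U : set V) (f g : V -> W) : open U ->
  (forall x, U x -> f x = g x) -> Cn_on k U f -> Cn_on k U g.
Proof.
move=> oU; elim: k f g => [|k IH] f g fg H.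
  split=> // x Ux; have fc := Cn_on_continuous H Ux.
  have nfg : \near x, f x = g x by apply: filterS (open_nbhs_nbhs (conj oU Ux)).
  rewrite /prop_for /continuous_at -fg//; apply: cvg_trans fc.
  by apply: near_eq_cvg; apply: filterS nfg => y ->.
have nfg x : U x -> \near x, f x = g x.
  by move=> Ux; apply: filterS (open_nbhs_nbhs (conj oU Ux)).
split.
  move=> x Ux; have fc := Cn_on_continuous H Ux.
  rewrite /prop_for /continuous_at -fg//; apply: cvg_trans fc.
  by apply: near_eq_cvg; apply: filterS (nfg _ Ux) => y ->.
move=> v; split.
  move=> x Ux; apply: near_eq_derivable (Cn_on_derivable (v := v) H Ux).
  exact: nfg.
apply: IH (Cn_on_derive v H) => x Ux.
by apply: near_eq_derive; exact: nfg.
Qed.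

Lemma Cn_on_cst V W k (U : set V) (w : W) : Cn_on k U (fun=> w).
Proof.
elim: k w => [|k IH] w; split=> //; try by move=> x _; exact: cvg_cst.
move=> v; split; first by move=> x _; exact: derivable_cst.
have -> : (fun x : V => 'D_v (fun=> w) x) = (fun=> 0).
  by apply/funext => x; rewrite derive_cst.
exact: IH.
Qed.

Lemma Cn_onD V W k (U : set V) (f g : V -> W) : open U ->
  Cn_on k U f -> Cn_on k U g -> Cn_on k U (fun x => f x + g x).
Proof.
move=> oU; elim: k f g => [|k IH] f g Hf Hg; split=> //;
  try by move=> x Ux; apply: cvgD;
    [exact: (Cn_on_continuous Hf)|exact: (Cn_on_continuous Hg)].
move=> v; split.
  by move=> x Ux; apply: (@derivableD _ _ _ f g);
    [exact: (Cn_on_derivable Hf)|exact: (Cn_on_derivable Hg)].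
apply: (Cn_on_ext oU _ (IH _ _ (Cn_on_derive v Hf) (Cn_on_derive v Hg))).
move=> x Ux; rewrite [RHS](@deriveD _ _ _ f g)//;
    [exact: (Cn_on_derivable Hf)|exact: (Cn_on_derivable Hg)].
Qed.

Lemma Cn_on_sum V W k (U : set V) (I : Type) (r : seq I) (F : I -> V -> W) :
  open U -> (forall i, Cn_on k U (F i)) ->
  Cn_on k U (fun x => \sum_(i <- r) F i x).
Proof.
move=> oU H; elim: r => [|i r IH].
  by under eq_fun do rewrite big_nil; exact: Cn_on_cst.
by under eq_fun do rewrite big_cons; exact: Cn_onD.
Qed.

Lemma Cn_onM V k (U : set V) (f g : V -> R) : open U ->
  Cn_on k U f -> Cn_on k U g -> Cn_on k U (fun x => f x * g x).
Proof.
move=> oU; elim: k f g => [|k IH] f g Hf Hg; split=> //;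
  try by move=> x Ux; apply: cvgM;
    [exact: (Cn_on_continuous Hf)|exact: (Cn_on_continuous Hg)].
move=> v; split.
  by move=> x Ux; apply: (@derivableM _ _ f g);
    [exact: (Cn_on_derivable Hf)|exact: (Cn_on_derivable Hg)].
have H1 := IH _ _ (Cn_onS Hf) (Cn_on_derive v Hg).
have H2 := IH _ _ (Cn_onS Hg) (Cn_on_derive v Hf).
apply: (Cn_on_ext oU _ (Cn_onD oU H1 H2)).
move=> x Ux; rewrite [RHS](@deriveM _ _ f g)//;
    [exact: (Cn_on_derivable Hf)|exact: (Cn_on_derivable Hg)].
Qed.

Lemma Cn_on_coord V n k (U : set V) (f : V -> 'rV[R]_n) i : open U ->
  Cn_on k U f -> Cn_on k U (fun x => f x 0 i).
Proof.
move=> oU; elim: k f => [|k IH] f Hf; split=> //.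
- by move=> x Ux; apply: (@continuous_comp _ _ _ f (fun y => y 0 i));
    [exact: (Cn_on_continuous Hf)|exact: coord_continuous].
- by move=> x Ux; apply: (@continuous_comp _ _ _ f (fun y => y 0 i));
    [exact: (Cn_on_continuous Hf)|exact: coord_continuous].
move=> v; split.
  by move=> x Ux; have /derivable_mxP := Cn_on_derivable (v := v) Hf Ux; exact.
apply: (Cn_on_ext oU _ (IH _ (Cn_on_derive v Hf))) => x Ux.
by rewrite derive_mx ?mxE//; exact: (Cn_on_derivable Hf Ux).
Qed.

Lemma rV_cvg (T : Type) (F : set_system T) (FF : Filter F) n
    (f : T -> 'rV[R]_n) (l : 'rV[R]_n) :
  (forall i, f x 0 i @[x --> F] --> l 0 i) -> f x @[x --> F] --> l.
Proof.
move=> H; apply/cvgrPdist_le => e e0.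
have : \forall x \near F, forall i, `|l 0 i - f x 0 i| <= e.
  apply: filter_forall => i; by move/cvgrPdist_le : (H i); exact.
apply: filterS => x Hx; apply: rV_norm_le; first exact: ltW.
by move=> i; rewrite !mxE; exact: Hx.
Qed.

Lemma Cn_on_row V n k (U : set V) (f : V -> 'rV[R]_n) : open U ->
  (forall i, Cn_on k U (fun x => f x 0 i)) -> Cn_on k U f.
Proof.
move=> oU; elim: k f => [|k IH] f Hf.
  by split=> // x Ux; apply: rV_cvg => i; exact: (Cn_on_continuous (Hf i)).
have fd v x : U x -> derivable f x v.
  move=> Ux; apply/derivable_mxP => i j; rewrite ord1.
  exact: (Cn_on_derivable (Hf j)).
split; first by move=> x Ux; apply: rV_cvg => i; exact: (Cn_on_continuous (Hf i)).
move=> v; split; first exact: fd.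
apply: IH => i; apply: (Cn_on_ext oU _ (Cn_on_derive v (Hf i))) => x Ux.
by rewrite derive_mx ?mxE//; exact: fd.
Qed.

Lemma derivable_affine V V' W (f : V -> W) (j l : V' -> V) x v :
  (forall h x v, j (h *: v + x) = h *: l v + j x) ->
  derivable f (j x) (l v) -> derivable (f \o j) x v.
Proof.
by move=> jl; rewrite /derivable /=; under [X in _ -> cvg (X @ _)]eq_fun do rewrite jl.
Qed.

(** The difference quotients coincide for each [h], hence so do their limits, whether or not these
    exist. *)
Lemma derive_affine V V' W (f : V -> W) (j l : V' -> V) v :
  (forall h x v, j (h *: v + x) = h *: l v + j x) ->
  'D_v (f \o j) = 'D_(l v) f \o j.
Proof.
move=> jl; apply/funext => x; rewrite /derive /=.
by under [X in lim (X @ _) = _]eq_fun do rewrite jl.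
Qed.

Lemma Cn_on_affine V V' W k (U : set V) (f : V -> W) (j l : V' -> V) :
  (forall h x v, j (h *: v + x) = h *: l v + j x) -> continuous j ->
  Cn_on k U f -> Cn_on k (j @^-1` U) (f \o j).
Proof.
move=> jl jc; elim: k f => [|k IH] f Hf; split=> //.
- by move=> x Ux; apply: (continuous_comp (jc x)); exact: (Cn_on_continuous Hf).
- by move=> x Ux; apply: (continuous_comp (jc x)); exact: (Cn_on_continuous Hf).
move=> v; split.
  by move=> x Ux; apply: derivable_affine jl _; exact: (Cn_on_derivable Hf Ux).
by rewrite (derive_affine _ _ jl); exact: IH (Cn_on_derive _ Hf).
Qed.

End CnCalculus.

(** * C^1 maps are differentiable; integral curves of smooth fields are smooth *)

Section C1Differentiable.
Context {R : realType} {n : nat}.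

(* Differentiability follows from telescoping [f (x + h) - f x] along the
   partial truncations of [h]. *)
Let trunc (h : 'rV[R]_n) (j : nat) : 'rV[R]_n :=
  \row_i (if (i < j)%N then h 0 i else 0).

Lemma C1_differentiable_scalar (U : set 'rV[R]_n) (f : 'rV[R]_n -> R)
    (x : 'rV[R]_n) : open U -> Cn_on 1 U f -> U x -> differentiable f x.
Proof.
move=> oU Hf Ux.
pose D i := 'D_('e_i) f.
pose df (h : 'rV[R]_n) : R := \sum_(i < n) h 0 i * D i x.
have df_lin : linear df.
  move=> a u v; rewrite /df scaler_sumr -big_split /=; apply: eq_bigr => i _.
  by rewrite !mxE mulrDl -mulrA.
pose dfL : {linear 'rV[R]_n -> R} :=
  HB.pack df (GRing.isLinear.Build _ _ _ _ _ df_lin).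
have cdf : continuous dfL.
  move=> y; apply: (@cvg_big _ _ +%R).
  - exact: add_continuous.
  - exact: nbhs_filter.
  - move=> i _; apply: (@cvgM _ _ _ _ (fun h : 'rV[R]_n => h 0 i)).
        exact: nbhs_filter.
      exact: coord_continuous.
    by apply: cvg_cst; exact: nbhs_filter.
suff : is_diff x f dfL by case.
apply: is_diff_epsP => // e e0.
(* There are [n] telescoping steps, each with an error of [e / n.+1] relative to [|h|]; [n.+1]
   covers [n = 0]. *)
have e'0 : 0 < e / n.+1%:R by rewrite divr_gt0.
have /near_norm_shiftP [d d0 Hb] : \forall y \near x,
    U y /\ forall i, `|D i x - D i y| <= e / n.+1%:R.
  near=> y; split; first by near: y; exact: open_nbhs_nbhs.
  near: y; apply: filter_forall => i.
  have /cvgrPdist_le := Cn_on_continuous (Cn_on_derive 'e_i Hf) Ux.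
  exact.
apply/near_norm_shiftP; exists d => // h hd; rewrite addr0 /= -/(df h).
have tn j : `|trunc h j| <= `|h|.
  apply: rV_norm_le => // i; rewrite mxE; case: ifP => _; last by rewrite normr0.
  exact: coord_norm_le.
have H (j : nat) : (j <= n)%N ->
  `|f (trunc h j + x) - f x - \sum_(i < n | (i < j)%N) h 0 i * D i x|
    <= j%:R * (e / n.+1%:R * `|h|).
  elim: j => [_|j IH jn].
    have -> : trunc h 0 = 0 by apply/rowP => i; rewrite !mxE.
    by rewrite big_pred0 // add0r subrr subr0 normr0 mul0r.
  pose oj := Ordinal jn; pose v := h 0 oj *: ('e_oj : 'rV[R]_n).
  have tS : trunc h j.+1 = v + trunc h j.
    apply/rowP => i; rewrite !mxE /= -val_eqE /= ltnS.
    have [ij|ij|ij] := ltngtP i j; rewrite ?mulr0 ?add0r ?addr0 //.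
    by rewrite mulr1; congr (h _ _); apply/val_inj.
  have tv t : 0 <= t <= 1 -> `|t *: v + trunc h j| <= `|h|.
    move=> /andP[t0 t1]; apply: rV_norm_le => // i.
    rewrite !mxE /= -val_eqE /=.
    have [ij|ij|ij] := ltngtP i j; rewrite ?mulr0 ?add0r ?addr0 ?normr0 //.
      exact: coord_norm_le.
    rewrite mulr1 normrM ger0_norm//.
    apply: le_trans (coord_norm_le h oj); rewrite -[leRHS]mul1r.
    exact: ler_wpM2r.
  have tU t : 0 <= t <= 1 -> U (t *: v + (trunc h j + x)).
    by move=> /tv tv1; rewrite addrA; apply: (Hb _ _).1; exact: le_lt_trans hd.
  have [t t01|t t01 E] := @mean_value_segment R _ f (trunc h j + x) v.
    exact: Cn_on_derivable Hf (tU t t01).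
  move/eqP: E; rewrite subr_eq => /eqP E.
  rewrite tS -[v + _ + x]addrA (bigD1 oj) //= E.
  rewrite derive_scale_dir; last exact: (Cn_on_derivable Hf (tU t t01)).
  have -> : \sum_(i < n | (i < j.+1)%N && (i != oj)) h 0 i * D i x =
            \sum_(i < n | (i < j)%N) h 0 i * D i x.
    by apply: eq_bigl => i; rewrite -val_eqE /= ltnS; case: ltngtP.
  set s := \sum_(i < n | _) _; set q := 'D__ f _.
  rewrite (_ : _ - _ = h 0 oj * (q - D oj x) + (f (trunc h j + x) - f x - s));
    last by rewrite -[h 0 oj *: q]/(h 0 oj * q); ring.
  rewrite (le_trans (ler_normD _ _))// mulrS mulrDl mul1r lerD//; last first.
    by apply: IH; exact: ltnW.
  rewrite normrM mulrC ler_pM//; last exact: coord_norm_le.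
  rewrite distrC /q addrA; apply: (Hb _ _).2.
  by rewrite (le_lt_trans _ hd)//; exact: tv.
have := H n (leqnn n).
have -> : trunc h n = h by apply/rowP => i; rewrite mxE ltn_ord.
rewrite (eq_bigl xpredT); last by move=> i; rewrite ltn_ord.
move=> /le_trans; apply; rewrite mulrA ler_wpM2r// mulrCA ler_piMr ?(ltW e0)//.
by rewrite ler_pdivrMr// mul1r ler_nat.
Unshelve. all: by end_near. Qed.

Lemma differentiable_row m (f : 'rV[R]_n -> 'rV[R]_m) (x : 'rV[R]_n) :
  (forall i, differentiable (fun y => f y 0 i) x) -> differentiable f x.
Proof.
move=> fd.
have -> : f = \sum_(i < m) (fun y => f y 0 i *: ('e_i : 'rV[R]_m)).
  apply/funext => y; rewrite [LHS]row_sum_delta.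
  by elim/big_rec2 : _ => // i u v _ ->.
by apply: differentiable_sum => i; exact: differentiableZl.
Qed.

Lemma C1_differentiable m (U : set 'rV[R]_n) (f : 'rV[R]_n -> 'rV[R]_m)
    (x : 'rV[R]_n) : open U -> Cn_on 1 U f -> U x -> differentiable f x.
Proof.
move=> oU Hf Ux; apply: differentiable_row => i.
apply: (C1_differentiable_scalar oU _ Ux); exact: (Cn_on_coord i oU Hf).
Qed.

Lemma derive_row_expand (W : normedModType R) (f : 'rV[R]_n -> W)
    (x v : 'rV[R]_n) : differentiable f x ->
  'D_v f x = \sum_(i < n) v 0 i *: 'D_('e_i) f x.
Proof.
move=> fd; rewrite deriveE// {1}(row_sum_delta v) linear_sum.
by apply: eq_bigr => i _; rewrite linearZ deriveE.
Qed.

Lemma is_derive_comp_curve (W : normedModType R) (f : 'rV[R]_n -> W)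
    (u : R -> 'rV[R]_n) (t : R) (v : 'rV[R]_n) :
  is_derive t 1 u v -> differentiable f (u t) ->
  is_derive t 1 (f \o u) ('D_v f (u t)).
Proof.
move=> [/derivable1_diffP ud uv] fd.
have cd : differentiable (f \o u) t by exact: differentiable_comp.
split; first exact/derivable1_diffP.
have uv1 : 'd u t 1 = v by rewrite -deriveE.
by rewrite deriveE// diff_comp//= uv1 deriveE.
Qed.

(* Bootstrapping: [(f \o u)' = (V . grad f) \o u], which has one derivative
   less than [f] but whose factor [V] is smooth. *)
Lemma smooth_on_integral_curve_comp (T : set R) (U : set 'rV[R]_n)
    (u : R -> 'rV[R]_n) (V : 'rV[R]_n -> 'rV[R]_n) :
  open T -> open U -> (forall t, T t -> U (u t)) -> smooth_on U V ->
  (forall t, T t -> is_derive t 1 u (V (u t))) ->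
  forall k (f : 'rV[R]_n -> R), Cn_on k.+1 U f -> Cn_on k T (f \o u).
Proof.
move=> oT oU TU HV Hu; elim=> [|k IH] f Hf.
  split=> // t Tt; apply: continuous_comp.
    by apply/differentiable_continuous/derivable1_diffP; case: (Hu t Tt).
  exact: (Cn_on_continuous Hf (TU _ Tt)).
pose LVf (x : 'rV[R]_n) : R := \sum_(i < n) V x 0 i * 'D_('e_i) f x.
have fd x : U x -> differentiable f x.
  apply: C1_differentiable_scalar oU _.
  by elim: k.+1 Hf {IH} => // k' IH' /Cn_onS; exact: IH'.
have HLVf : Cn_on k.+1 U LVf.
  apply: Cn_on_sum => // i; apply: Cn_onM => //; last exact: Cn_on_derive.
  by apply: Cn_on_coord => //; exact: HV.
have Hc t : T t -> is_derive t 1 (f \o u) (LVf (u t)).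
  move=> Tt; have := is_derive_comp_curve (Hu t Tt) (fd _ (TU _ Tt)).
  by rewrite derive_row_expand //; exact: fd (TU _ Tt).
split.
  move=> t Tt; apply/differentiable_continuous/derivable1_diffP.
  by case: (Hc t Tt).
move=> v; split.
  move=> t Tt; rewrite -[v]mulr1 -[v * 1]/(v *: 1).
  by apply: derivable_scale_dir; case: (Hc t Tt).
apply: (Cn_on_ext oT _ (Cn_onM oT (Cn_on_cst k T v) (IH _ HLVf))) => t Tt.
have [Hd He] := Hc t Tt.
by rewrite -[v in RHS]mulr1 -[v * 1]/(v *: 1) derive_scale_dir// He.
Qed.

Lemma Cn_on_proj k (U : set 'rV[R]_n) i : Cn_on k U (fun x => x 0 i : R).
Proof.
have Dc v : 'D_v (fun x : 'rV[R]_n => x 0 i : R) = fun=> v 0 i.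
  apply/funext => x; apply: derive_val; apply/is_derive_epsP => e e0.
  near=> h; rewrite !mxE addrK subrr normr0.
  by apply: mulr_ge0 => //; exact: ltW.
case: k => [|k]; split=> //; try by move=> x _; exact: coord_continuous.
move=> v; split; last by rewrite Dc; exact: Cn_on_cst.
by move=> x _; apply: diff_derivable; exact: differentiable_coord.
Unshelve. all: by end_near. Qed.

Lemma smooth_on_integral_curve (T : set R) (U : set 'rV[R]_n)
    (u : R -> 'rV[R]_n) (V : 'rV[R]_n -> 'rV[R]_n) :
  open T -> open U -> (forall t, T t -> U (u t)) -> smooth_on U V ->
  (forall t, T t -> is_derive t 1 u (V (u t))) -> smooth_on T u.
Proof.
move=> oT oU TU HV Hu k; apply: Cn_on_row => // i.
apply: (@smooth_on_integral_curve_comp T U u V oT oU TU HV Hu k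
  (fun x => x 0 i)).
exact: Cn_on_proj.
Qed.

End C1Differentiable.

(** * Partial maps of a function on a product *)

Section Slices.
Context {R : realType} {V1 V2 W : normedModType R}.
Implicit Types (F : V1 * V2 -> W) (O : set (V1 * V2)).

Lemma pairl_affine (z : V2) (h : R) (y u : V1) :
  (h *: u + y, z) = h *: (u, 0) + (y, z) :> V1 * V2.
Proof. by congr pair; rewrite /= scaler0 add0r. Qed.

Lemma pairr_affine (y : V1) (h : R) (z u : V2) :
  (y, h *: u + z) = h *: (0, u) + (y, z) :> V1 * V2.
Proof. by congr pair; rewrite /= scaler0 add0r. Qed.

Lemma continuous_pairl (z : V2) : continuous (fun y : V1 => (y, z)).
Proof. by move=> y; apply: cvg_pair; [exact: cvg_id|exact: cvg_cst]. Qed.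

Lemma continuous_pairr (y : V1) : continuous (fun z : V2 => (y, z)).
Proof. by move=> z; apply: cvg_pair; [exact: cvg_cst|exact: cvg_id]. Qed.

Lemma open_pairl O (z : V2) : open O -> open [set y | O (y, z)].
Proof. by move=> oO; apply: open_comp => // y _; exact: continuous_pairl. Qed.

Lemma open_pairr O (y : V1) : open O -> open [set z | O (y, z)].
Proof. by move=> oO; apply: open_comp => // z _; exact: continuous_pairr. Qed.

Lemma Cn_on_pairl k O F z : Cn_on k O F ->
  Cn_on k [set y | O (y, z)] (fun y => F (y, z)).
Proof. exact: Cn_on_affine (pairl_affine z) (@continuous_pairl z). Qed.

Lemma Cn_on_pairr k O F y : Cn_on k O F ->
  Cn_on k [set z | O (y, z)] (fun z => F (y, z)).
Proof. exact: Cn_on_affine (pairr_affine y) (@continuous_pairr y). Qed.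

Lemma derivable_pairl F y z u : derivable F (y, z) (u, 0) ->
  derivable (fun y => F (y, z)) y u.
Proof. exact: derivable_affine (pairl_affine z). Qed.

Lemma derivable_pairr F y z u : derivable F (y, z) (0, u) ->
  derivable (fun z => F (y, z)) z u.
Proof. exact: derivable_affine (pairr_affine y). Qed.

Lemma derive_pairl F y z u :
  'D_u (fun y => F (y, z)) y = 'D_(u, 0) F (y, z).
Proof. exact: (congr1 (@^~ y) (derive_affine F u (pairl_affine z))). Qed.

Lemma derive_pairr F y z u :
  'D_u (fun z => F (y, z)) z = 'D_(0, u) F (y, z).
Proof. exact: (congr1 (@^~ z) (derive_affine F u (pairr_affine y))). Qed.

End Slices.

(** * Second-order estimates for the group law in a chart *)

Section MixedDifference.
Context {R : realType} {n m : nat}.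
Implicit Types (F : 'rV[R]_n * 'rV[R]_n -> 'rV[R]_m)
  (O : set ('rV[R]_n * 'rV[R]_n)) (y z u : 'rV[R]_n).

Lemma derive_left_expand O F y z u : open O -> Cn_on 1 O F -> O (y, z) ->
  'D_(u, 0) F (y, z) = \sum_(i < n) u 0 i *: 'D_('e_i, 0) F (y, z).
Proof.
move=> oO HF Oyz; rewrite -derive_pairl.
have d := C1_differentiable (open_pairl z oO) (Cn_on_pairl z HF) Oyz.
rewrite (derive_row_expand u d).
by apply: eq_bigr => i _; rewrite derive_pairl.
Qed.

Lemma derive_right_expand O F y z u : open O -> Cn_on 1 O F -> O (y, z) ->
  'D_(0, u) F (y, z) = \sum_(i < n) u 0 i *: 'D_(0, 'e_i) F (y, z).
Proof.
move=> oO HF Oyz; rewrite -derive_pairr.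
have d := C1_differentiable (open_pairr y oO) (Cn_on_pairr y HF) Oyz.
rewrite (derive_row_expand u d).
by apply: eq_bigr => i _; rewrite derive_pairr.
Qed.

Lemma row_comb_norm_le p (u : 'rV[R]_n) (w : 'I_n -> 'rV[R]_p) K : 0 <= K ->
  (forall i, `|w i| <= K) -> `|\sum_(i < n) u 0 i *: w i| <= n%:R * K * `|u|.
Proof.
move=> K0 H; apply: le_trans (ler_norm_sum _ _ _) _.
apply: (@le_trans _ _ (\sum_(i < n) K * `|u|)).
  apply: ler_sum => i _; rewrite normrZ mulrC ler_pM//; exact: coord_norm_le.
by rewrite sumr_const card_ord -[leLHS]mulr_natl mulrA.
Qed.

Lemma segment_norm_lt p (x y : 'rV[R]_p) r (t : R) : `|x| < r -> `|y| < r ->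
  0 <= t <= 1 -> `|t *: (x - y) + y| < r.
Proof.
move=> xr yr /andP[t0 t1].
have -> : t *: (x - y) + y = t *: x + (1 - t) *: y.
  by rewrite scalerBr scalerBl scale1r addrAC -addrA.
apply: le_lt_trans (ler_normD _ _) _.
rewrite !normrZ (ger0_norm t0) ger0_norm ?subr_ge0//.
have [->|tn0] := eqVneq t 0; first by rewrite mul0r add0r subr0 mul1r.
have -> : r = t * r + (1 - t) * r by ring.
apply: ltr_leD; first by rewrite ltr_pM2l// lt_neqAle eq_sym tn0.
by rewrite ler_wpM2l ?subr_ge0// ltW.
Qed.

Lemma ler_sum_pair (I J : finType) (T : I -> J -> R) i j :
  (forall i j, 0 <= T i j) -> T i j <= \sum_i \sum_j T i j.
Proof.
move=> T0; rewrite (bigD1 i) // (bigD1 j) //= -addrA lerDl addr_ge0 //.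
  by apply: sumr_ge0 => k _.
by apply: sumr_ge0 => k _; apply: sumr_ge0 => l _.
Qed.

(** Two mean value inequalities: the difference in [x] is controlled by the [x]-derivative of
    [F (x, y) - F (x, y')], and that derivative, itself a difference in [y], by the mixed second
    derivatives. Expanding a direction in the basis costs a factor [n] each time. *)
Lemma mixed_difference O F a b : open O -> Cn_on 2 O F -> O (a, b) ->
  exists C r : R, [/\ 0 <= C, 0 < r &
    forall x x' y y', `|x| < r -> `|x'| < r -> `|y| < r -> `|y'| < r ->
      `|F (x + a, y + b) - F (x + a, y' + b)
        - (F (x' + a, y + b) - F (x' + a, y' + b))| <= C * `|x - x'| * `|y - y'|].
Proof.
move=> oO HF Oab.
pose H i j q := 'D_(0, 'e_j) ('D_('e_i, 0) F) q.
have HFi i : Cn_on 1 O ('D_('e_i, 0) F) by exact: Cn_on_derive.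
(* A common bound near [(a, b)]: each mixed derivative exceeds its value at [(a, b)] by at most 1
   there, by continuity. *)
pose K := \sum_i \sum_j (`|H i j (a, b)| + 1).
have K0 : 0 <= K by apply: sumr_ge0 => i _; apply: sumr_ge0 => j _; rewrite addr_ge0.
have : \forall q \near (a, b), O q /\ forall i j, `|H i j q| <= K.
  near=> q; split; first by near: q; exact: open_nbhs_nbhs.
  near: q; apply: filter_forall => i; apply: filter_forall => j.
  have cH : {for (a, b), continuous (H i j)}.
    exact: (Cn_on_continuous (Cn_on_derive _ (HFi i)) Oab).
  have /cvgrPdist_le /(_ 1 ltr01) := cH; apply: filterS => q Hq.
  apply: (@le_trans _ _ (`|H i j (a, b)| + 1)).
    rewrite addrC -lerBlDr; apply: le_trans Hq.
    by rewrite distrC; exact: lerB_dist.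
  apply: (ler_sum_pair (T := fun i j => `|H i j (a, b)| + 1)) => i' j'.
  by rewrite addr_ge0.
case=> -[A B] [/= /near_norm_shiftP[r1 r10 HA] /near_norm_shiftP[r2 r20 HB]] sAB.
pose r := Num.min r1 r2.
have r0 : 0 < r by rewrite lt_min r10.
have Hr x y : `|x| < r -> `|y| < r ->
    O (x + a, y + b) /\ forall i j, `|H i j (x + a, y + b)| <= K.
  rewrite /r !lt_min => /andP[xr _] /andP[_ yr]; apply: sAB.
  by split; [exact: HA|exact: HB].
exists (n%:R * (n%:R * K)), r; split=> //.
  by rewrite !mulr_ge0.
move=> x x' y y' xr x'r yr y'r.
have inner i x0 : `|x0| < r ->
    `|'D_('e_i, 0) F (x0 + a, y + b) - 'D_('e_i, 0) F (x0 + a, y' + b)|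
      <= n%:R * K * `|y - y'|.
  move=> x0r.
  have := @mean_value_ineq R _ _
    (fun z => 'D_('e_i, 0) F (x0 + a, z)) (y' + b) (y - y') 0
    (n%:R * K * `|y - y'|).
  rewrite subr0 addrA subrK; apply => t t01.
  - have [OO _] := Hr _ _ x0r (segment_norm_lt yr y'r t01).
    by apply: (derivable_pairr (F := 'D_('e_i, 0) F)); rewrite addrA;
      exact: Cn_on_derivable (HFi i) OO.
  - rewrite subr0 (derive_pairr ('D_('e_i, 0) F)) addrA.
    have [OO HH] := Hr _ _ x0r (segment_norm_lt yr y'r t01).
    rewrite (derive_right_expand _ oO (HFi i) OO).
    by apply: row_comb_norm_le => // j; exact: HH.
have := @mean_value_ineq R _ _
    (fun x => F (x, y + b) - F (x, y' + b)) (x' + a) (x - x') 0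
    (n%:R * (n%:R * K) * `|x - x'| * `|y - y'|).
rewrite subr0 addrA subrK; apply => t t01.
- have [xO _] := Hr _ _ (segment_norm_lt xr x'r t01) yr.
  have [x2O _] := Hr _ _ (segment_norm_lt xr x'r t01) y'r.
  by apply: derivableB; apply: (derivable_pairl (F := F)); rewrite addrA;
    [exact: Cn_on_derivable HF xO|exact: Cn_on_derivable HF x2O].
- have [xO _] := Hr _ _ (segment_norm_lt xr x'r t01) yr.
  have [x2O _] := Hr _ _ (segment_norm_lt xr x'r t01) y'r.
  have H1 := Cn_onS HF.
  rewrite subr0 [X in `|X|]deriveB; first last.
  + by apply: (derivable_pairl (F := F)); rewrite addrA; exact: Cn_on_derivable HF x2O.
  + by apply: (derivable_pairl (F := F)); rewrite addrA; exact: Cn_on_derivable HF xO.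
  rewrite !(derive_pairl F) !addrA.
  rewrite (derive_left_expand _ oO H1 xO) (derive_left_expand _ oO H1 x2O) -sumrB.
  under eq_bigr do rewrite -scalerBr.
  apply: le_trans (row_comb_norm_le (K := n%:R * K * `|y - y'|) _ _ _) _.
  + by rewrite !mulr_ge0.
  + by move=> i; apply: inner; exact: segment_norm_lt.
  + by rewrite le_eqVlt; apply/orP; left; apply/eqP; ring.
Unshelve. all: by end_near. Qed.

End MixedDifference.

Lemma open_setX (T U : topologicalType) (A : set T) (B : set U) :
  open A -> open B -> open (A `*` B).
Proof.
move=> oA oB; rewrite openE => -[x y] [/= Ax By]; exists (A, B) => //=.
by split; apply: open_nbhs_nbhs.
Qed.

Lemma subr_interchange (V : zmodType) (a b x y : V) :
  (a - x) - (b - y) = a - b - (x - y).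
Proof. by rewrite opprD addrACA -opprD. Qed.

(** * Charts and the group law read in them *)

Section Charts.
Context {R : realType}.

(** The set on which [smooth_map] asks the coordinate expression of [f] to be smooth. *)
Definition chart_source (M N : topologicalType) (E F : normedModType R)
    (c : chart M E) (d : chart N F) (f : M -> N) : set E :=
  cmap c @` (cdom c `&` f @^-1` cdom d).

Lemma cimgP (M : topologicalType) (E : normedModType R) (c : chart M E) y :
  is_chart c -> cimg c y -> cdom c (cinv c y) /\ cmap c (cinv c y) = y.
Proof. by move=> [_ _ cK _ _] [x xc <-]; rewrite cK. Qed.

Lemma open_chart_source (M N : topologicalType) (E F : normedModType R)
    (c : chart M E) (d : chart N F) (f : M -> N) :
  is_chart c -> open (cdom d) -> continuous f -> open (chart_source c d f).
Proof.
move=> cc od cf; have [oc oi cK _ ic] := cc.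
have -> : chart_source c d f = cimg c `&` (f \o cinv c) @^-1` cdom d.
  apply/seteqP; split=> [y [x [xc /= xd] <-]|y [yc yd]].
    by split; [exists x|rewrite /preimage /= cK].
  have [h1 h2] := cimgP cc yc.
  by exists (cinv c y).
rewrite openE => y [yc yd]; apply: filterI; first exact: open_nbhs_nbhs.
have : {for y, continuous (f \o cinv c)}.
  by apply: continuous_comp; [exact: ic|exact: cf].
by apply; exact: open_nbhs_nbhs.
Qed.

Lemma is_chart_prod (M N : topologicalType) (E F : normedModType R)
    (c : chart M E) (d : chart N F) :
  is_chart c -> is_chart d -> is_chart (prod_chart c d).
Proof.
move=> [oc oci cK cc ci] [od odi dK dc di].
have img q : cimg (prod_chart c d) q <-> cimg c q.1 /\ cimg d q.2.
  split=> [[x [xc xd] <-]|[[x xc xE] [y yd yE]]].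
    by split; [exists x.1|exists x.2].
  by exists (x, y) => //=; rewrite xE yE -surjective_pairing.
split.
- exact: open_setX.
- have -> : cimg (prod_chart c d) = cimg c `*` cimg d.
    by apply/seteqP; split=> q /img.
  exact: open_setX.
- by move=> x [xc xd]; rewrite /= cK // dK // -surjective_pairing.
- move=> x [xc xd]; apply: cvg_pair.
    by apply: (@continuous_comp _ _ _ fst); [exact: cvg_fst|exact: cc].
  by apply: (@continuous_comp _ _ _ snd); [exact: cvg_snd|exact: dc].
- move=> y /img[yc yd]; apply: cvg_pair.
    by apply: (@continuous_comp _ _ _ fst); [exact: cvg_fst|exact: ci].
  by apply: (@continuous_comp _ _ _ snd); [exact: cvg_snd|exact: di].
Qed.

End Charts.

Section LieGroupCharts.
Context {R : realType} {n : nat} {G : lieGroupType R n}.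
Implicit Types (c d e : chart G 'rV[R]_n).

Lemma lie_chart c : lie_atlas c -> is_chart c.
Proof. by have [+ _ _] := @lie_atlasP R n G; exact. Qed.

Lemma lie_mul_continuous : continuous (fun q : G * G => (q.1 * q.2)%g).
Proof. by have [] := @lie_mul_smooth R n G. Qed.

Lemma lie_inv_continuous : continuous (fun x : G => x^-1%g).
Proof. by have [] := @lie_inv_smooth R n G. Qed.

Definition mul_in_charts c d e (q : 'rV[R]_n * 'rV[R]_n) : 'rV[R]_n :=
  cmap e (cinv c q.1 * cinv d q.2)%g.

Definition mul_source c d e : set ('rV[R]_n * 'rV[R]_n) :=
  chart_source (prod_chart c d) e (fun q : G * G => (q.1 * q.2)%g).

Lemma mul_in_charts_smooth c d e : lie_atlas c -> lie_atlas d -> lie_atlas e ->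
  smooth_on (mul_source c d e) (mul_in_charts c d e).
Proof.
move=> Ac Ad Ae; have [_ H] := @lie_mul_smooth R n G.
by apply: (H (prod_chart c d) e) => //; exists c, d.
Qed.

Lemma open_mul_source c d e : lie_atlas c -> lie_atlas d -> lie_atlas e ->
  open (mul_source c d e).
Proof.
move=> /lie_chart cc /lie_chart cd /lie_chart[oe _ _ _ _].
by apply: open_chart_source => //; [exact: is_chart_prod|exact: lie_mul_continuous].
Qed.

Lemma mul_sourceP c d e y z : lie_atlas c -> lie_atlas d ->
  cimg c y -> cimg d z -> cdom e (cinv c y * cinv d z)%g ->
  mul_source c d e (y, z).
Proof.
move=> Ac Ad yc zd H.
have [h1 h2] := cimgP (lie_chart Ac) yc; have [h3 h4] := cimgP (lie_chart Ad) zd.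
by exists (cinv c y, cinv d z) => //=; rewrite h2 h4.
Qed.

End LieGroupCharts.

Section LocalCoordinates.
Context {R : realType} {n : nat} {G : lieGroupType R n}.
Context (c : chart G 'rV[R]_n) (c1 : chart_at_identity c).

Definition centered_inv (x : 'rV[R]_n) : G := cinv c (x + cmap c 1%g).
Definition centered_map (g : G) : 'rV[R]_n := cmap c g - cmap c 1%g.

Local Notation iota := centered_inv.
Local Notation kappa := centered_map.

Lemma centered_mapK g : cdom c g -> iota (kappa g) = g.
Proof.
move=> gc; have [_ _ cK _ _] := lie_chart c1.1.
by rewrite /centered_inv subrK cK.
Qed.

Lemma centered_invP x : cimg c (x + cmap c 1%g) ->
  cdom c (iota x) /\ kappa (iota x) = x.
Proof.
move=> xc; have [h1 h2] := cimgP (lie_chart c1.1) xc.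
by split => //; rewrite /centered_map /centered_inv h2 addrK.
Qed.

Lemma centered_map1 : kappa 1%g = 0.
Proof. by rewrite /centered_map subrr. Qed.

Lemma centered_inv0 : iota 0 = 1%g.
Proof. by rewrite -centered_map1 centered_mapK //; exact: c1.2. Qed.

(** In centered coordinates a product with 0 is the other factor. Both bounds are therefore
    [mixed_difference] with one point put at 0: they say that the deviation of the product from
    [x + y] is Lipschitz in each variable, with a constant that shrinks with the other one. *)
Lemma local_group_estimates : exists C r : R,
  [/\ 0 <= C, 0 < r,
    forall x, `|x| < r -> cimg c (x + cmap c 1%g),
    forall x y, `|x| < r -> `|y| < r -> cdom c (iota x * iota y)%g &
    (forall x x' y, `|x| < r -> `|x'| < r -> `|y| < r ->
      `|kappa (iota x * iota y)%g - kappa (iota x' * iota y)%g - (x - x')|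
        <= C * `|x - x'| * `|y|) /\
    (forall x y y', `|x| < r -> `|y| < r -> `|y'| < r ->
      `|kappa (iota x * iota y)%g - kappa (iota x * iota y')%g - (y - y')|
        <= C * `|x| * `|y - y'|)].
Proof.
have [Ac c1dom] := c1.
pose p := cmap c 1%g; pose O := mul_source c c c; pose F := mul_in_charts c c c.
have [oc oi cK _ _] := lie_chart Ac.
have oO : open O by exact: open_mul_source.
have pi : cimg c p by exists 1%g.
have Opp : O (p, p).
  by apply: mul_sourceP => //; rewrite cK // mulg1.
have HF : Cn_on 2 O F by exact: mul_in_charts_smooth.
have [C [r1 [C0 r10 H]]] := mixed_difference oO HF Opp.
have /near_norm_shiftP [r2 r20 Hi] : \forall y \near p, cimg c y.
  exact: open_nbhs_nbhs.
have : \forall q \near (p, p), O q by exact: open_nbhs_nbhs.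
case=> -[A B] [/= /near_norm_shiftP[r3 r30 HA] /near_norm_shiftP[r4 r40 HB]] sAB.
pose r := Num.min (Num.min r1 r2) (Num.min r3 r4).
have r0 : 0 < r by rewrite !lt_min r10 r20 r30.
have rP (x : 'rV[R]_n) : `|x| < r -> [/\ `|x| < r1, `|x| < r2, `|x| < r3 & `|x| < r4].
  by rewrite !lt_min => /andP[/andP[-> ->] /andP[-> ->]].
have FE x y : F (x + p, y + p) = kappa (iota x * iota y)%g + p.
  by rewrite /centered_map subrK.
have n0r : `|0 : 'rV[R]_n| < r by rewrite normr0.
have Fx0 x : `|x| < r -> F (x + p, p) = x + p.
  move=> /rP[_ xr2 _ _]; rewrite -{2}[p]add0r FE centered_inv0 mulg1.
  by have [_ ->] := centered_invP (Hi _ xr2).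
have F0y y : `|y| < r -> F (p, y + p) = y + p.
  move=> /rP[_ yr2 _ _]; rewrite -{1}[p]add0r FE centered_inv0 mul1g.
  by have [_ ->] := centered_invP (Hi _ yr2).
have addpK (a b : 'rV[R]_n) : a + p - (b + p) = a - b.
  by rewrite opprD addrACA subrr addr0.
exists C, r; split=> //.
- by move=> x /rP[_ xr2 _ _]; exact: Hi.
- move=> x y /rP[_ _ xr _] /rP[_ _ _ yr].
  have [[g h] [/= [gc hc] ghc] [gE hE]] : O (x + p, y + p).
    by apply: sAB; split; [exact: HA|exact: HB].
  by rewrite /centered_inv -[cmap c 1%g]/p -gE -hE !cK.
- split=> [x x' y xr x'r yr|x y y' xr yr y'r].
    have := H x x' y 0; rewrite normr0 subr0 add0r.
    case: (rP x xr) => -> _ _ _; case: (rP x' x'r) => -> _ _ _.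
    case: (rP y yr) => -> _ _ _; rewrite r10 => /(_ isT isT isT isT).
    rewrite Fx0 // Fx0 // !FE; by rewrite !addpK subr_interchange.
  have := H x 0 y y'; rewrite normr0 subr0 add0r.
  case: (rP x xr) => -> _ _ _; case: (rP y' y'r) => -> _ _ _.
  case: (rP y yr) => -> _ _ _; rewrite r10 => /(_ isT isT isT isT).
  rewrite F0y // F0y // !FE; by rewrite !addpK subr_interchange.
Qed.

End LocalCoordinates.

(** * Limits, local homomorphisms and perturbations of the identity *)

Lemma continuous_addr (R : realType) (V : normedModType R) (p : V) :
  continuous (fun x => x + p).
Proof. by move=> x; apply: cvgD; [exact: cvg_id|exact: cvg_cst]. Qed.

Lemma squeeze_norm (R : realType) (V : normedModType R) (T : Type)
    (F : set_system T) {FF : Filter F} (f : T -> V) (l : V) (b : T -> R) :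
  (\forall x \near F, `|f x - l| <= b x) -> b x @[x --> F] --> (0 : R) ->
  f x @[x --> F] --> l.
Proof.
move=> H /cvgrPdist_le b0; apply/cvgrPdist_le => e e0.
apply: filterS2 H (b0 e e0) => x H1; rewrite sub0r normrN distrC => H2.
exact: le_trans H1 (le_trans (ler_norm _) H2).
Qed.

Lemma rV_cauchy_cvg (R : realType) (n : nat) (u : nat -> 'rV[R]_n) (K : R) :
  (forall j k, `|u j - u k| <= K * (j.+1%:R^-1 + k.+1%:R^-1)) -> cvgn u.
Proof.
move=> H; apply/cauchy_cvgP/cauchy_ballP => e e0.
have e20 : 0 < e / 2 by rewrite divr_gt0.
have : K * k.+1%:R^-1 @[k --> \oo] --> (0 : R).
  by rewrite -(mulr0 K); apply: cvgMr; exact: cvg_harmonic.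
move=> /cvgrPdist_lt /(_ _ e20) [N _ HN].
exists (u @` [set j | (N <= j)%N], u @` [set j | (N <= j)%N]).
  by split; exists N => // k Nk; exists k.
move=> [_ _] [[j /= Nj <-] [k /= Nk <-]]; rewrite -ball_normE /=.
apply: le_lt_trans (H j k) _; rewrite mulrDr [e]splitr ltrD //.
  by have := HN j Nj; rewrite /= sub0r normrN; apply: le_lt_trans; exact: ler_norm.
by have := HN k Nk; rewrite /= sub0r normrN; apply: le_lt_trans; exact: ler_norm.
Qed.

Section ExtendLocalHom.
Context {R : realType} {G : groupType}.
Context (e : R -> G) (d : R) (d0 : 0 < d).
Context (eD : forall s t, `|s| < d -> `|t| < d -> `|s + t| < d ->
  e (s + t) = (e s * e t)%g).

Lemma local_homX j v : `|j.+1%:R * v| < d -> e (j.+1%:R * v) = (e v ^+ j.+1)%g.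
Proof.
elim: j => [|j IH]; first by rewrite mul1r expg1.
move=> H.
have vd : `|v| < d.
  apply: le_lt_trans H; rewrite normrM -[leLHS]mul1r ler_wpM2r//.
  by rewrite ger0_norm // ler1n.
have jd : `|j.+1%:R * v| < d.
  apply: le_lt_trans H; rewrite !normrM ler_wpM2r//.
  by rewrite !ger0_norm // ler_nat.
have E : j.+2%:R * v = j.+1%:R * v + v by rewrite -[in LHS]natr1 mulrDl mul1r.
by rewrite E eD; [rewrite IH // [RHS]expgSr|exact: jd|exact: vd|rewrite -E].
Qed.

(* [e (t / N) ^ N] does not depend on [N], provided that [t / N] is small. *)
Let N (t : R) := (Num.truncn (`|t| / d)).+1.
Let gamma t := (e (t / (N t)%:R) ^+ N t)%g.

Let small t M : `|t| / d < M.+1%:R -> `|t / M.+1%:R| < d.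
Proof.
move=> H; rewrite normrM normfV [`|M.+1%:R|]ger0_norm//.
by rewrite ltr_pdivrMr// mulrC -ltr_pdivrMr.
Qed.

Let NP t : `|t| / d < (N t)%:R.
Proof.
have /andP[_] := Num.Theory.truncn_itv (divr_ge0 (normr_ge0 t) (ltW d0)).
exact.
Qed.

(** Two subdivisions of [t] are compared through their common refinement, whose number of parts is
    the product of the two numbers. *)
Let gammaE t M : `|t| / d < M.+1%:R -> gamma t = (e (t / M.+1%:R) ^+ M.+1)%g.
Proof.
move=> H; rewrite /gamma; have := NP t; rewrite /N; set L := Num.truncn _ => HL.
have key a b : `|t / a.+1%:R| < d ->
    (e (t / a.+1%:R) ^+ a.+1)%g = (e (t / (a.+1 * b.+1)%:R) ^+ (a.+1 * b.+1))%g.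
  move=> Ha; have E : t / a.+1%:R = b.+1%:R * (t / (a.+1 * b.+1)%:R).
    by rewrite natrM invfM [RHS]mulrC -!mulrA mulVf ?mulr1 // pnatr_eq0.
  by rewrite E local_homX; [rewrite -expgnA mulnC|rewrite -E].
by rewrite (key _ M (small HL)) (key _ L (small H)) mulnC.
Qed.

Lemma extend_local_hom : exists gamma : R -> G,
  (forall s t, gamma (s + t) = (gamma s * gamma t)%g) /\
  forall s, `|s| < d -> gamma s = e s.
Proof.
exists gamma; split=> [s t|s sd].
  pose M := Num.truncn ((`|s| + `|t|) / d).
  have HM : (`|s| + `|t|) / d < M.+1%:R.
    have /andP[_] := Num.Theory.truncn_itv
      (divr_ge0 (addr_ge0 (normr_ge0 s) (normr_ge0 t)) (ltW d0)).
    exact.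
  have le u : `|u| <= `|s| + `|t| -> `|u| / d < M.+1%:R.
    by move=> H; apply: le_lt_trans HM; rewrite ler_wpM2r // invr_ge0 ltW.
  have Hs : `|s| / d < M.+1%:R by apply: le; rewrite lerDl.
  have Ht : `|t| / d < M.+1%:R by apply: le; rewrite lerDr.
  have Hst : `|s + t| / d < M.+1%:R by apply: le; exact: ler_normD.
  rewrite (gammaE Hs) (gammaE Ht) (gammaE Hst) mulrDl eD ?small //; last first.
    by rewrite -mulrDl small.
  (* The two factors commute because [e] sends both orders of the sum to the same point. *)
  rewrite expgMn // /commute -!eD ?small // 1?addrC // -mulrDl ?small //.
  by rewrite addrC.
have Hs : `|s| / d < 1%:R by rewrite ltr_pdivrMr// mul1r.
by rewrite (gammaE Hs) divr1 expg1.
Qed.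

End ExtendLocalHom.

Lemma dist_limit_le (R : realType) (V : normedModType R) (u : nat -> V)
    (a l : V) (b : nat -> R) (b0 : R) : u @ \oo --> l -> b @ \oo --> b0 ->
  (forall N, `|a - u N| <= b N) -> `|a - l| <= b0.
Proof.
move=> ul bb H.
have al : `|a - u N| @[N --> \oo] --> `|a - l|.
  by apply: cvg_norm; apply: cvgB => //; exact: cvg_cst.
by apply: (ler_cvg_to al bb); exact: nearW.
Qed.

(** Approximation by integer powers only reaches nonnegative multiples. In each sign pattern the
    relation is rearranged until all arguments are nonnegative, for instance as
    [s = (s + t) + (- t)] when [t <= 0 <= s + t]; [P] stands for smallness. *)
Lemma local_hom_signed (R : realType) (G : groupType) (e : R -> G)
    (P : R -> Prop) :
  (forall s, P s -> P (- s)) ->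
  (forall s, P s -> e (- s) = (e s)^-1%g) ->
  (forall s t, 0 <= s -> 0 <= t -> P s -> P t -> P (s + t) ->
    e (s + t) = (e s * e t)%g) ->
  forall s t, P s -> P t -> P (s + t) -> e (s + t) = (e s * e t)%g.
Proof.
move=> PN eN eD s t Ps Pt Pst.
have pos (a : R) : (0 <= - a) = (a <= 0) by rewrite oppr_ge0.
have [s0|/ltW s0] := lerP 0 s; have [t0|/ltW t0] := lerP 0 t.
- exact: eD.
- have [st|/ltW st] := lerP 0 (s + t).
    have := eD (s + t) (- t); rewrite pos addrK => /(_ st t0 Pst (PN _ Pt) Ps) ->.
    by rewrite eN // mulgVK.
  have := eD (- (s + t)) s; rewrite pos opprD addrAC addNr add0r -opprD.
  move=> /(_ st s0 (PN _ Pst) Ps (PN _ Pt)); rewrite !eN // => H.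
  by apply: invg_inj; rewrite invgM H mulgK.
- have [st|/ltW st] := lerP 0 (s + t).
    have := eD (- s) (s + t); rewrite pos addKr => /(_ s0 st (PN _ Ps) Pst Pt) ->.
    by rewrite eN // mulVKg.
  have := eD t (- (s + t)); rewrite pos opprD addrCA subrr addr0 -opprD.
  move=> /(_ t0 st Pt (PN _ Pst) (PN _ Ps)); rewrite !eN // => H.
  by apply: invg_inj; rewrite invgM H mulKg.
- have := eD (- t) (- s); rewrite !pos -opprD (addrC t).
  move=> /(_ t0 s0 (PN _ Pt) (PN _ Ps) (PN _ Pst)); rewrite !eN // => H.
  by apply: invg_inj; rewrite H invgM.
Qed.
Lemma cvg_near (T : Type) (U : topologicalType) (F : set_system T)
    (f : T -> U) (l : U) (P : U -> Prop) :
  f x @[x --> F] --> l -> (\forall y \near l, P y) -> \forall x \near F, P (f x).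
Proof. by move=> fl; exact: fl. Qed.

(* The solution is the limit of the iteration [x <- x + (y - E x)]. *)
Lemma near_identity_surj (R : realType) (n : nat) (E : 'rV[R]_n -> 'rV[R]_n)
    (d : R) (y : 'rV[R]_n) :
  (forall x x', `|x| <= d -> `|x'| <= d ->
    `|E x - E x' - (x - x')| <= 2^-1 * `|x - x'|) ->
  E 0 = 0 -> `|y| <= d / 2 -> exists2 x, `|x| <= 2 * `|y| & E x = y.
Proof.
move=> EL E0 yd.
pose x := fix x k : 'rV[R]_n := if k is k'.+1 then x k' + (y - E (x k')) else 0.
pose q k : R := 2^-1 ^+ k.
have qS k : q k.+1 = 2^-1 * q k by rewrite /q exprS.
have q0 k : 0 < q k by rewrite exprn_gt0.
have y0 := normr_ge0 y.
have qy k : 0 <= q k * `|y| by rewrite mulr_ge0 // ltW.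
(* The residual halves at each step, so the corrections sum to at most [2 |y| <= d] and the iterates
   stay where [EL] applies. *)
have H k : `|x k| <= 2 * (1 - q k) * `|y| /\ `|y - E (x k)| <= q k * `|y|.
  elim: k => [|k [IH1 IH2]].
    by rewrite /x E0 /q expr0 subrr mulr0 mul0r normr0 subr0 mul1r.
  have xS : x k.+1 = x k + (y - E (x k)) by [].
  have x1 : `|x k.+1| <= 2 * (1 - q k.+1) * `|y|.
    by rewrite xS; apply: le_trans (ler_normD _ _) _; rewrite qS; lra.
  split => //.
  have xd : `|x k| <= d by have := qy k; lra.
  have xd1 : `|x k.+1| <= d by have := qy k.+1; lra.
  have := EL _ _ xd1 xd; have dx : x k.+1 - x k = y - E (x k) by rewrite xS addrAC subrr add0r.
  have -> : E (x k.+1) - E (x k) - (x k.+1 - x k) = - (y - E (x k.+1)).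
    by rewrite dx; apply/rowP => i; rewrite !mxE; ring.
  rewrite normrN dx => /le_trans; apply; rewrite qS; lra.
have dist k m : `|x (k + m)%N - x k| <= 2 * (q k - q (k + m)%N) * `|y|.
  elim: m => [|m IH]; first by rewrite addn0 !subrr normr0 mulr0 mul0r.
  rewrite addnS; have -> : x (k + m).+1 - x k =
    (x (k + m)%N - x k) + (y - E (x (k + m)%N)) by rewrite /= addrAC.
  by apply: le_trans (ler_normD _ _) _; have := (H (k + m)%N).2; rewrite qS; lra.
(* A crude comparison, to reach the harmonic rate that [rV_cauchy_cvg] expects. *)
have qinv k : q k <= k.+1%:R^-1.
  rewrite /q exprVn lef_pV2 ?posrE ?exprn_gt0 // -natrX ler_nat.
  exact: ltn_expl.
have dist' j k : (j <= k)%N ->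
    `|x j - x k| <= 2 * `|y| * (j.+1%:R^-1 + k.+1%:R^-1).
  move=> jk; rewrite distrC -(subnKC jk); apply: le_trans (dist _ _) _.
  rewrite mulrAC ler_wpM2l ?mulr_ge0 //.
  apply: lerD; first exact: qinv.
  by apply: (@le_trans _ _ 0); [rewrite oppr_le0 ltW|rewrite invr_ge0].
have cvg_x : cvgn x.
  apply: (rV_cauchy_cvg (K := 2 * `|y|)) => j k.
  have [jk|/ltnW kj] := leqP j k; first exact: dist'.
  by have := dist' _ _ kj; rewrite distrC [k.+1%:R^-1 + _]addrC.
have xl : x @ \oo --> limn x by [].
have q_cvg : q k * `|y| @[k --> \oo] --> (0 : R).
  rewrite -(mul0r `|y|); apply: cvgMl; apply: cvg_expr.
  by rewrite ger0_norm // invf_lt1 // ltr1n.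
have xn : `|limn x| <= 2 * `|y|.
  rewrite -normrN -sub0r; apply: (dist_limit_le xl (b := fun=> 2 * `|y|)).
    exact: cvg_cst.
  by move=> N; rewrite sub0r normrN; have := (H N).1; have := qy N; lra.
exists (limn x) => //; apply/eqP; rewrite eq_sym -subr_eq0 -normr_le0.
have Ex : E (x N) @[N --> \oo] --> E (limn x).
  apply: (squeeze_norm (b := fun N => 3 / 2 * `|x N - limn x|)).
    apply: nearW => N.
    have xd : `|x N| <= d by have := (H N).1; have := qy N; lra.
    have ld : `|limn x| <= d by lra.
    have := EL _ _ xd ld; rewrite -{2}[E (x N) - _](subrK (x N - limn x)).
    by move=> ?; apply: le_trans (ler_normD _ _) _; lra.
  rewrite -[X in _ --> X](mulr0 (3 / 2)); apply: cvgMr.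
  rewrite -(@normr0 _ 'rV[R]_n) -(subrr (limn x)); apply: cvg_norm.
  by apply: cvgB => //; exact: cvg_cst.
by apply: (dist_limit_le Ex q_cvg) => N; have [] := H N.
Qed.

(** * The exponential map near the identity *)

Section LocalExp.
Context {R : realType} {n : nat} {G : lieGroupType R n}.
Context (c : chart G 'rV[R]_n) (c1 : chart_at_identity c).

Local Notation iota := (centered_inv c).
Local Notation kappa := (centered_map c).

Context (C r : R) (C0 : 0 <= C) (r0 : 0 < r).
Context (Himg : forall x : 'rV[R]_n, `|x| < r -> cimg c (x + cmap c 1%g)).
Context (Hdom : forall x y : 'rV[R]_n, `|x| < r -> `|y| < r ->
  cdom c (iota x * iota y)%g).
Context (Hleft : forall x x' y : 'rV[R]_n,
  `|x| < r -> `|x'| < r -> `|y| < r ->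
  `|kappa (iota x * iota y)%g - kappa (iota x' * iota y)%g - (x - x')|
     <= C * `|x - x'| * `|y|).
Context (Hright : forall x y y' : 'rV[R]_n,
  `|x| < r -> `|y| < r -> `|y'| < r ->
  `|kappa (iota x * iota y)%g - kappa (iota x * iota y')%g - (y - y')|
     <= C * `|x| * `|y - y'|).

(* Small enough for the powers [x ^ j] with [j * |x| <= exp_radius] to stay in
   the domain of the estimates. *)
Definition exp_radius : R := Num.min (r / 4) ((8 * (C + 1))^-1).
Local Notation rho := exp_radius.

Lemma exp_radius_gt0 : 0 < rho.
Proof. by rewrite lt_min divr_gt0 //= invr_gt0 mulr_gt0 // ltr_wpDl. Qed.

Lemma exp_radius_le : 4 * rho <= r.
Proof. by rewrite mulrC -ler_pdivlMr// ge_min lexx. Qed.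

(** The 8 is dictated by [power_lipschitz]: one more factor there costs [(3 / 2 + 2) * (C * rho)],
    which has to stay below [1 / 2]. *)
Lemma exp_radiusC : 8 * (C * rho) <= 1.
Proof.
have C1 : 0 < 8 * (C + 1) by rewrite mulr_gt0 // ltr_wpDl.
have : (8 * (C + 1)) * rho <= 1.
  by rewrite mulrC -ler_pdivlMr// div1r ge_min lexx orbT.
by have := exp_radius_gt0; nra.
Qed.

Lemma centered_invK x : `|x| < r -> kappa (iota x) = x.
Proof. by move=> /Himg /(centered_invP c1)[]. Qed.

Lemma centered_inv_continuous x : `|x| < r -> {for x, continuous iota}.
Proof.
move=> xr; have [_ _ _ _ ci] := lie_chart c1.1.
apply: (@continuous_comp _ _ _ (fun x => x + cmap c 1%g) (cinv c)).
  exact: continuous_addr.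
exact: ci (Himg xr).
Qed.

Lemma centered_mulK x y : `|x| < r -> `|y| < r ->
  iota (kappa (iota x * iota y)%g) = (iota x * iota y)%g.
Proof. by move=> xr yr; apply: centered_mapK => //; exact: Hdom. Qed.

Lemma centered_mul_estimate x y : `|x| < r -> `|y| < r ->
  `|kappa (iota x * iota y)%g - (x + y)| <= C * `|x| * `|y|.
Proof.
move=> xr yr; have n0 : `|0 : 'rV[R]_n| < r by rewrite normr0.
have := Hleft xr n0 yr.
by rewrite centered_inv0 // mul1g centered_invK // subr0 -addrA -opprD (addrC y).
Qed.

Let pw (x : 'rV[R]_n) (j : nat) : 'rV[R]_n := kappa (iota x ^+ j)%g.

Let rhor (x : 'rV[R]_n) : `|x| <= 2 * rho -> `|x| < r.
Proof.
by have := exp_radius_le; have := exp_radius_gt0; lra.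
Qed.

Let step_small (j : nat) (X : R) : 0 <= X -> j.+1%:R * X <= rho ->
  j%:R * X <= rho /\ X <= rho.
Proof.
move=> X0; rewrite -natr1 mulrDl mul1r => H.
by have : 0 <= j%:R * X; [rewrite mulr_ge0|lra].
Qed.

(** Each further factor adds at most [2 |x|] to the norm: [|x|] itself, and a quadratic error
    [C |x^j| |x|] that the choice of radius keeps below [|x|]. *)
Lemma power_coord x j : j%:R * `|x| <= rho ->
  iota (pw x j) = (iota x ^+ j)%g /\ `|pw x j| <= 2 * (j%:R * `|x|).
Proof.
elim: j => [_|j IH].
  by rewrite /pw expg0 centered_map1 centered_inv0 // normr0 mul0r mulr0.
move=> H; have [H1 H2] := step_small (normr_ge0 x) H.
have [IH1 IH2] := IH H1.
have pr : `|pw x j| < r by apply: rhor; lra.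
have xr : `|x| < r by apply: rhor; have := exp_radius_gt0; lra.
have E : pw x j.+1 = kappa (iota (pw x j) * iota x)%g.
  by rewrite IH1 -expgSr.
rewrite E; split; first by rewrite centered_mulK // IH1 -expgSr.
have := centered_mul_estimate pr xr; set m := kappa _ => mE.
have CA : C * `|pw x j| <= 1.
  by have := exp_radiusC; have := ler_wpM2l C0 IH2; have := ler_wpM2l C0 H1; lra.
have := ler_wpM2r (normr_ge0 x) CA; rewrite -natr1 mulrDl mul1r.
have : `|m| <= `|m - (pw x j + x)| + (`|pw x j| + `|x|).
  rewrite -{1}[m](subrK (pw x j + x)); apply: le_trans (ler_normD _ _) _.
  by rewrite lerD2l; exact: ler_normD.
lra.
Qed.

Lemma power_coord_small x j : j%:R * `|x| <= rho -> `|pw x j| < r.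
Proof. by move=> H; apply: rhor; have [_] := power_coord H; lra. Qed.

Lemma power_coordS x j : j.+1%:R * `|x| <= rho ->
  pw x j.+1 = kappa (iota (pw x j) * iota x)%g.
Proof.
move=> H; have [H1 _] := step_small (normr_ge0 x) H.
by rewrite (power_coord H1).1 -expgSr.
Qed.

(** The step from [j] to [j + 1] adds an error of at most [2 C j |x|^2], and
    [2 j <= (j + 1)^2 - j^2]. *)
Lemma power_second_order x j : j%:R * `|x| <= rho ->
  `|pw x j - j%:R *: x| <= C * (j%:R * `|x|) ^+ 2.
Proof.
elim: j => [_|j IH].
  by rewrite /pw expg0 centered_map1 scale0r subr0 normr0 mul0r expr0n mulr0.
move=> H; have [H1 H2] := step_small (normr_ge0 x) H.
have xr : `|x| < r by apply: rhor; have := exp_radius_gt0; lra.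
rewrite (power_coordS H).
have := centered_mul_estimate (power_coord_small H1) xr; set m := kappa _ => mE.
have [_ pE] := power_coord H1.
have -> : m - j.+1%:R *: x = (m - (pw x j + x)) + (pw x j - j%:R *: x).
  by apply/rowP => i; rewrite -natr1 !mxE; ring.
apply: le_trans (ler_normD _ _) _.
have := IH H1; have := ler_wpM2r (normr_ge0 x) (ler_wpM2l C0 pE).
have : 0 <= C * `|x| ^+ 2 by rewrite mulr_ge0 // exprn_ge0.
rewrite -natr1; lra.
Qed.

(** In the limit this makes exp a perturbation of the identity with Lipschitz constant 1/2. In the
    inductive step the product is changed one factor at a time, the left one by [Hleft] and the
    right one by [Hright]. *)
Lemma power_lipschitz x x' j : j%:R * `|x| <= rho -> j%:R * `|x'| <= rho ->
  `|pw x j - pw x' j - j%:R *: (x - x')| <= 2^-1 * (j%:R * `|x - x'|).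
Proof.
elim: j => [_ _|j IH].
  by rewrite /pw !expg0 subrr scale0r subr0 normr0 mul0r mulr0.
move=> H H'; have [H1 H2] := step_small (normr_ge0 x) H.
have [H1' H2'] := step_small (normr_ge0 x') H'.
have xr : `|x| < r by apply: rhor; have := exp_radius_gt0; lra.
have xr' : `|x'| < r by apply: rhor; have := exp_radius_gt0; lra.
rewrite (power_coordS H) (power_coordS H').
have pr := power_coord_small H1; have pr' := power_coord_small H1'.
have L := Hleft pr pr' xr; have M := Hright pr' xr xr'.
move: L M (IH H1 H1') (power_coord H1).2 (power_coord H1').2.
set m1 := kappa (iota (pw x j) * _)%g; set m2 := kappa (iota (pw x' j) * iota x)%g.
set m3 := kappa (iota (pw x' j) * iota x')%g; move=> L M I P P'.
have -> : m1 - m3 - j.+1%:R *: (x - x') =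
    (m1 - m2 - (pw x j - pw x' j)) + (m2 - m3 - (x - x'))
    + (pw x j - pw x' j - j%:R *: (x - x')).
  by apply/rowP => i; rewrite -natr1 !mxE; ring.
have pd : `|pw x j - pw x' j| <= 2^-1 * (j%:R * `|x - x'|) + j%:R * `|x - x'|.
  rewrite -[X in `|X|](subrK (j%:R *: (x - x'))); apply: le_trans (ler_normD _ _) _.
  by rewrite lerD //= normrZ ger0_norm.
apply: le_trans (ler_normD _ _) _; apply: le_trans (lerD (ler_normD _ _) (lexx _)) _.
have X0 := normr_ge0 x; have D0 := normr_ge0 (x - x').
have JD0 : 0 <= j%:R * `|x - x'| by rewrite mulr_ge0.
have T1 : C * `|pw x j - pw x' j| * `|x| <= 3 / 2 * (C * rho) * `|x - x'|.
  have -> : 3 / 2 * (C * rho) * `|x - x'| = C * (3 / 2 * rho * `|x - x'|) by ring.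
  rewrite -mulrA ler_wpM2l //.
  apply: le_trans (ler_wpM2r X0 pd) _.
  by have := ler_wpM2r D0 H1; lra.
have T2 : C * `|pw x' j| * `|x - x'| <= 2 * (C * rho) * `|x - x'|.
  rewrite ler_wpM2r //; have := ler_wpM2l C0 P'; have := ler_wpM2l C0 H1'; lra.
have T3 := ler_wpM2r D0 exp_radiusC.
rewrite -[j.+1%:R]natr1 mulrDl mul1r; lra.
Qed.

(* Comparing the approximations [(x / k) ^ (j k)] and [x ^ j], by applying
   [power_lipschitz] to [x] and [(x / k) ^ k]. *)
Lemma power_refine x j k : j.+1%:R * `|x| <= rho / 2 ->
  `|pw x j.+1 - pw (k.+1%:R^-1 *: x) (j.+1 * k.+1)|
    <= 2 * C * (j.+1%:R * `|x| ^+ 2).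
Proof.
move=> H; have j1 : 1 <= j.+1%:R :> R by rewrite ler1n.
have X0 := normr_ge0 x; have rh0 := exp_radius_gt0.
have xr : `|x| <= rho.
  by have := ler_wpM2r X0 j1; lra.
have kx : k.+1%:R * `|k.+1%:R^-1 *: x| = `|x|.
  by rewrite normrZ ger0_norm ?invr_ge0// mulrA mulfV ?mul1r// pnatr_eq0.
have Hk : k.+1%:R * `|k.+1%:R^-1 *: x| <= rho by rewrite kx.
pose y := pw (k.+1%:R^-1 *: x) k.+1.
have [yE yN] := power_coord Hk; have yS := power_second_order Hk.
rewrite -/y kx in yE yN yS.
rewrite scalerA mulfV ?pnatr_eq0// scale1r in yS.
have -> : pw (k.+1%:R^-1 *: x) (j.+1 * k.+1) = pw y j.+1.
  by rewrite /pw yE -expgnA mulnC.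
have J0 : 0 <= j.+1%:R :> R by [].
have Hy : j.+1%:R * `|y| <= rho.
  by have := ler_wpM2l J0 yN; lra.
have Hx : j.+1%:R * `|x| <= rho by lra.
have L := power_lipschitz Hx Hy; rewrite distrC in yS.
have -> : pw x j.+1 - pw y j.+1 =
  (pw x j.+1 - pw y j.+1 - j.+1%:R *: (x - y)) + j.+1%:R *: (x - y).
  by rewrite subrK.
apply: le_trans (ler_normD _ _) _.
have -> : `|j.+1%:R *: (x - y)| = j.+1%:R * `|x - y| by rewrite normrZ ger0_norm.
have := ler_wpM2l J0 yS.
have : 0 <= C * (j.+1%:R * `|x| ^+ 2).
  by rewrite !mulr_ge0 // exprn_ge0.
lra.
Qed.

Let approx (X : 'rV[R]_n) (N : nat) := pw (N.+1%:R^-1 *: X) N.+1.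

Let half_radius_pos : 0 < rho / 2.
Proof. by rewrite divr_gt0 // exp_radius_gt0. Qed.

Let scaleN (X : 'rV[R]_n) N : N.+1%:R * `|N.+1%:R^-1 *: X| = `|X|.
Proof. by rewrite normrZ ger0_norm ?invr_ge0// mulrA mulfV ?mul1r// pnatr_eq0. Qed.

(** Both approximants are compared with the one using [j.+1 * k.+1] factors. *)
Lemma approx_dist X j k : `|X| <= rho / 2 ->
  `|approx X j - approx X k| <= 2 * C * `|X| ^+ 2 * (j.+1%:R^-1 + k.+1%:R^-1).
Proof.
move=> H.
have bnd (N : nat) : 2 * C * (N.+1%:R * `|N.+1%:R^-1 *: X| ^+ 2) =
    2 * C * `|X| ^+ 2 * N.+1%:R^-1.
  rewrite normrZ ger0_norm ?invr_ge0// exprMn expr2.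
  have : N.+1%:R != 0 :> R by rewrite pnatr_eq0.
  by move: N.+1%:R => m m0; field.
have Hj := @power_refine (j.+1%:R^-1 *: X) j k; rewrite scaleN bnd in Hj.
have Hk := @power_refine (k.+1%:R^-1 *: X) k j; rewrite scaleN bnd in Hk.
rewrite scalerA [_^-1 * _]mulrC -scalerA mulnC in Hk.
rewrite -[approx X j - _](subrKA (pw (k.+1%:R^-1 *: (j.+1%:R^-1 *: X)) (j.+1 * k.+1))).
apply: le_trans (ler_normD _ _) _; rewrite mulrDr lerD //; first exact: Hj.
by rewrite distrC; exact: Hk.
Qed.

Definition local_exp (X : 'rV[R]_n) : 'rV[R]_n := limn (approx X).
Local Notation E := local_exp.

Lemma local_exp_cvg X : `|X| <= rho / 2 -> approx X @ \oo --> E X.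
Proof.
by move=> H; apply: (rV_cauchy_cvg (K := 2 * C * `|X| ^+ 2)) => j k;
  exact: approx_dist.
Qed.

Let inv_nat_cvg (a b : R) : a * (b + N.+1%:R^-1) @[N --> \oo] --> a * b.
Proof.
apply: cvgMr; rewrite -[X in _ --> X]addr0.
by apply: cvgD; [exact: cvg_cst|exact: cvg_harmonic].
Qed.

(** For [j > 0], [x^j] is itself an approximant of [E (j x)], and the other index of [approx_dist]
    goes to infinity. The bound is linear in [j] and quadratic in [x], so it vanishes when [x] tends
    to 0 while [j x] stays bounded. *)
Lemma local_exp_approx x j : j%:R * `|x| <= rho / 2 ->
  `|pw x j - E (j%:R *: x)| <= 2 * C * (j%:R * `|x| ^+ 2).
Proof.
case: j => [_|j H].
  rewrite scale0r mul0r mulr0.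
  have p0 N : pw 0 N = 0.
    by rewrite /pw centered_inv0 // expg1n centered_map1.
  suff -> : E 0 = 0 by rewrite subr0 /pw expg0 centered_map1 normr0.
  rewrite /local_exp /approx; under eq_fun do rewrite scaler0 p0.
  by rewrite lim_cst.
have Xr : `|j.+1%:R *: x| <= rho / 2 by rewrite normrZ ger0_norm.
have xE : pw x j.+1 = approx (j.+1%:R *: x) j.
  by rewrite /approx scalerA mulVf ?scale1r ?pnatr_eq0.
have b (N : nat) := approx_dist j N Xr.
have -> : 2 * C * (j.+1%:R * `|x| ^+ 2) = 2 * C * `|j.+1%:R *: x| ^+ 2 * j.+1%:R^-1.
  rewrite normrZ ger0_norm// exprMn expr2.
  have : j.+1%:R != 0 :> R by rewrite pnatr_eq0.
  by move: j.+1%:R => m m0; field.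
rewrite xE; exact: (dist_limit_le (local_exp_cvg Xr)
  (@inv_nat_cvg (2 * C * `|j.+1%:R *: x| ^+ 2) j.+1%:R^-1) b).
Qed.

Lemma local_exp0 : E 0 = 0.
Proof.
have := @local_exp_approx 0 0; rewrite !mul0r mulr0 scale0r /pw expg0 centered_map1.
by rewrite sub0r normrN => /(_ (ltW half_radius_pos)); rewrite normr_le0 => /eqP.
Qed.

Lemma local_exp_lipschitz X X' : `|X| <= rho / 2 -> `|X'| <= rho / 2 ->
  `|E X - E X' - (X - X')| <= 2^-1 * `|X - X'|.
Proof.
move=> H H'; have rh0 := exp_radius_gt0.
rewrite distrC; apply: (dist_limit_le (u := fun N => approx X N - approx X' N)
  (b := fun=> 2^-1 * `|X - X'|)).
- by apply: cvgB; exact: local_exp_cvg.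
- exact: cvg_cst.
move=> N; rewrite /approx distrC.
have := @power_lipschitz (N.+1%:R^-1 *: X) (N.+1%:R^-1 *: X') N.+1.
rewrite !scaleN -scalerBr scaleN scalerA mulfV ?scale1r ?pnatr_eq0//.
by apply; lra.
Qed.

Lemma local_exp_norm X : `|X| <= rho / 2 -> `|E X| <= 2 * `|X|.
Proof.
move=> H; have h0 : `|0 : 'rV[R]_n| <= rho / 2 by rewrite normr0 ltW.
have := local_exp_lipschitz H h0; rewrite local_exp0 !subr0 => L.
have := ler_normD (E X - X) X; rewrite subrK; have := normr_ge0 X; lra.
Qed.

Lemma local_exp_small X : `|X| <= rho / 2 -> `|E X| < r.
Proof.
move=> H; have := local_exp_norm H; have := exp_radius_le.
by have := exp_radius_gt0; lra.
Qed.

(** The source of all identities for exp: additivity, inverses and uniqueness each amount to finding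
    the limit of [j k] times the coordinates of [g k]. With [j k |x|] bounded by [rho / 2], the
    error in [local_exp_approx] is at most [C rho |x|], which tends to 0. *)
Lemma exp_of_powers (g : nat -> G) (j : nat -> nat) Z : `|Z| < rho / 2 ->
  kappa (g k) @[k --> \oo] --> (0 : 'rV[R]_n) ->
  (\forall k \near \oo, iota (kappa (g k)) = g k) ->
  (j k)%:R *: kappa (g k) @[k --> \oo] --> Z ->
  (g k ^+ j k)%g @[k --> \oo] --> iota (E Z).
Proof.
move=> Zr g0 gK jgZ; have rh0 := exp_radius_gt0.
have small : \forall k \near \oo, `|(j k)%:R *: kappa (g k)| < rho / 2.
  exact: cvgr_norm_lt jgZ _ Zr.
have pc : pw (kappa (g k)) (j k) @[k --> \oo] --> E Z.
  apply: (squeeze_norm (b := fun k => C * rho * `|kappa (g k)| +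
      3 / 2 * `|(j k)%:R *: kappa (g k) - Z|)).
    apply: filterS small => k; set x := kappa (g k) => xr.
    have xr' : (j k)%:R * `|x| <= rho / 2.
      by move: xr; rewrite normrZ ger0_norm // => /ltW.
    have H1 := local_exp_approx xr'.
    have H2 := local_exp_lipschitz (ltW xr) (ltW Zr).
    rewrite -[pw x (j k) - _](subrKA (E ((j k)%:R *: x))).
    apply: le_trans (ler_normD _ _) _; apply: lerD.
      apply: le_trans H1 _; rewrite -[C * rho * _]mulrA expr2.
      have := ler_wpM2l C0 (ler_wpM2r (normr_ge0 x) xr'); lra.
    rewrite -[E _ - E Z](subrK ((j k)%:R *: x - Z)).
    by apply: le_trans (ler_normD _ _) _; lra.
  rewrite -[X in _ --> X](addr0 0); apply: cvgD.
    rewrite -[X in _ --> X](mulr0 (C * rho)); apply: cvgMr.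
    by rewrite -(@normr0 _ 'rV[R]_n); exact: cvg_norm g0.
  rewrite -[X in _ --> X](mulr0 (3 / 2)); apply: cvgMr.
  rewrite -(@normr0 _ 'rV[R]_n) -(subrr Z); apply: cvg_norm.
  by apply: cvgB => //; exact: cvg_cst.
have ic := centered_inv_continuous (local_exp_small (ltW Zr)).
have : iota (pw (kappa (g k)) (j k)) @[k --> \oo] --> iota (E Z).
  exact: (cvg_comp _ _ pc ic).
apply: cvg_trans; apply: near_eq_cvg; apply: filterS2 small gK => k xr gk.
rewrite (power_coord _).1 ?gk //.
by move: xr; rewrite normrZ ger0_norm //; lra.
Qed.

Lemma mulg_cvg (T : Type) (F : set_system T) {FF : Filter F} (u v : T -> G) (a b : G) :
  u x @[x --> F] --> a -> v x @[x --> F] --> b ->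
  (u x * v x)%g @[x --> F] --> (a * b)%g.
Proof.
move=> ua vb; have := cvg_comp _ _ (cvg_pair ua vb) (@lie_mul_continuous R n G (a, b)).
exact.
Qed.

Lemma invg_cvg (T : Type) (F : set_system T) {FF : Filter F} (u : T -> G) (a : G) :
  u x @[x --> F] --> a -> (u x)^-1%g @[x --> F] --> a^-1%g.
Proof.
by move=> ua; exact: cvg_comp _ _ ua (@lie_inv_continuous R n G a).
Qed.

Lemma limg_unique (u : nat -> G) (a b : G) : u @ \oo --> a -> u @ \oo --> b -> a = b.
Proof. exact: (cvg_unique (@lie_hausdorff R n G)). Qed.

Let root_small (X : 'rV[R]_n) N : `|X| < rho / 2 -> `|N.+1%:R^-1 *: X| < r.
Proof.
move=> H; have := exp_radius_le; have := exp_radius_gt0.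
have : `|N.+1%:R^-1 *: X| <= `|X|.
  rewrite normrZ ger0_norm ?invr_ge0// ler_piMl// invf_le1 ?ltr0n//.
  by rewrite ler1n.
lra.
Qed.

Let root_cvg0 (X : 'rV[R]_n) : N.+1%:R^-1 *: X @[N --> \oo] --> (0 : 'rV[R]_n).
Proof.
by rewrite -(scale0r X); apply: cvgZl; exact: cvg_harmonic.
Qed.

Let root_floor (s : R) (X : 'rV[R]_n) : 0 <= s ->
  (Num.truncn (s * N.+1%:R))%:R *: (N.+1%:R^-1 *: X) @[N --> \oo] --> s *: X.
Proof.
move=> s0; under eq_fun do rewrite scalerA; apply: cvgZl.
apply: (squeeze_norm (b := fun N => N.+1%:R^-1)); last exact: cvg_harmonic.
apply: nearW => N.
have sN : 0 <= s * N.+1%:R by rewrite mulr_ge0.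
have /andP[h1 h2] := Num.Theory.truncn_itv sN.
have N0 : 0 < N.+1%:R :> R by [].
have -> : (Num.truncn (s * N.+1%:R))%:R / N.+1%:R - s =
    ((Num.truncn (s * N.+1%:R))%:R - s * N.+1%:R) / N.+1%:R.
  by rewrite mulrBl mulfK // gt_eqF.
rewrite normrM [X in _ * X]ger0_norm ?invr_ge0//.
rewrite ler_piMl ?invr_ge0// ler_norml; move: h1 h2; rewrite -natr1; lra.
Qed.

(** A real multiple [s] is reached by integer powers of a root of order [N.+1], because the integer
    part of [s * N.+1], divided by [N.+1], tends to [s]. *)
Lemma exp_floor (s : R) X : `|X| < rho / 2 -> 0 <= s -> `|s *: X| < rho / 2 ->
  (iota (N.+1%:R^-1 *: X) ^+ Num.truncn (s * N.+1%:R))%g @[N --> \oo]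
    --> iota (E (s *: X)).
Proof.
move=> Xr s0 sXr.
have kE N : kappa (iota (N.+1%:R^-1 *: X)) = N.+1%:R^-1 *: X.
  by rewrite centered_invK //; exact: root_small.
apply: exp_of_powers => //.
- by under eq_fun do rewrite kE; exact: root_cvg0.
- by apply: nearW => N; rewrite kE.
- by under eq_fun do rewrite kE; exact: root_floor.
Qed.

Lemma exp_add_nonneg (s t : R) X : `|X| < rho / 2 -> 0 <= s -> 0 <= t ->
  `|s *: X| < rho / 2 -> `|t *: X| < rho / 2 -> `|(s + t) *: X| < rho / 2 ->
  iota (E ((s + t) *: X)) = (iota (E (s *: X)) * iota (E (t *: X)))%g.
Proof.
move=> Xr s0 t0 sX tX stX.
apply: (limg_unique _ (mulg_cvg (exp_floor Xr s0 sX) (exp_floor Xr t0 tX))).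
(* The exponents add up to a sum of two integer parts. It may differ from the integer part for
   [s + t], but its quotient by [N.+1] has the same limit, and that is all [exp_of_powers] looks
   at. *)
under [X in X @ _]eq_fun do rewrite -expgnDr.
have kE N : kappa (iota (N.+1%:R^-1 *: X)) = N.+1%:R^-1 *: X.
  by rewrite centered_invK //; exact: root_small.
apply: exp_of_powers => //.
- by under eq_fun do rewrite kE; exact: root_cvg0.
- by apply: nearW => N; rewrite kE.
- under eq_fun do rewrite kE natrD scalerDl.
  by rewrite scalerDl; apply: cvgD; exact: root_floor.
Qed.

Lemma centered_map_cvg (T : Type) (F : set_system T) {FF : Filter F}
    (g : T -> G) : g x @[x --> F] --> 1%g ->
  kappa (g x) @[x --> F] --> (0 : 'rV[R]_n).
Proof.
move=> g1; have [_ _ _ cc _] := lie_chart c1.1.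
have H : cmap c (g x) @[x --> F] --> cmap c 1%g.
  exact: cvg_comp _ _ g1 (cc _ c1.2).
by rewrite -(subrr (cmap c 1%g)); apply: cvgB => //; exact: cvg_cst.
Qed.

Lemma centered_mapK_near (T : Type) (F : set_system T) {FF : Filter F}
    (g : T -> G) : g x @[x --> F] --> 1%g ->
  \forall x \near F, iota (kappa (g x)) = g x.
Proof.
move=> g1; have [oc _ _ _ _] := lie_chart c1.1.
have : \forall x \near F, cdom c (g x).
  by apply: g1; exact: open_nbhs_nbhs (conj oc c1.2).
by apply: filterS => x; exact: centered_mapK.
Qed.

(* [N * kappa ((X / N)^-1)] tends to [- X], so [exp_of_powers] identifies the
   limit of the [N]-th powers of [(X / N)^-1]. *)
Lemma exp_opp X : `|X| < rho / 2 -> iota (E (- X)) = (iota (E X))^-1%g.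
Proof.
move=> Xr; have n0 : `|0 : 'rV[R]_n| < r by rewrite normr0.
pose x N := N.+1%:R^-1 *: X; pose g N := (iota (x N))^-1%g.
have ix : iota (x N) @[N --> \oo] --> 1%g.
  rewrite -[1%g](centered_inv0 c1).
  exact: cvg_comp _ _ (@root_cvg0 X) (centered_inv_continuous n0).
have g1 : g N @[N --> \oo] --> 1%g by rewrite -invg1; exact: invg_cvg.
have gK : \forall N \near \oo, iota (kappa (g N)) = g N.
  exact: centered_mapK_near.
have g0 : kappa (g N) @[N --> \oo] --> (0 : 'rV[R]_n) by exact: centered_map_cvg.
have inv : (g N ^+ N.+1)%g @[N --> \oo] --> (iota (E X))^-1%g.
  rewrite /g; under eq_fun do rewrite expVgn.
  apply: invg_cvg.
  have := @exp_floor 1 X Xr ler01; rewrite scale1r => /(_ Xr).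
  by under eq_fun do rewrite mul1r Num.Theory.natrK.
apply: (limg_unique _ inv); apply: (exp_of_powers _ g0 gK); first by rewrite normrN.
apply: (squeeze_norm (b := fun N => C * `|X| * `|kappa (g N)|)); last first.
  rewrite -[X in _ --> X](mulr0 (C * `|X|)); apply: cvgMr.
  by rewrite -(@normr0 _ 'rV[R]_n); exact: cvg_norm g0.
have zr : \forall N \near \oo, `|kappa (g N)| < r by exact: cvgr_norm_lt g0 _ n0.
apply: filterS2 gK zr => N gN zN.
have xr := root_small N Xr.
(* The product of an element and its inverse has coordinates 0, so the product estimate bounds the
   sum of their coordinates. *)
have := centered_mul_estimate xr zN; rewrite gN /g mulgV centered_map1.
rewrite sub0r normrN => H.
have -> : N.+1%:R *: kappa (iota (x N))^-1%g - - X =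
    N.+1%:R *: (x N + kappa (iota (x N))^-1%g).
  by rewrite /x; move: (kappa _) => z; rewrite opprK scalerDr scalerA
    mulfV ?pnatr_eq0// scale1r addrC.
rewrite normrZ ger0_norm//; apply: le_trans (ler_wpM2l _ H) _ => //.
by rewrite -mulrA mulrCA [N.+1%:R * (_ * _)]mulrA scaleN mulrA.
Qed.

Lemma exp_add (s t : R) X : `|X| < rho / 2 ->
  `|s *: X| < rho / 2 -> `|t *: X| < rho / 2 -> `|(s + t) *: X| < rho / 2 ->
  iota (E ((s + t) *: X)) = (iota (E (s *: X)) * iota (E (t *: X)))%g.
Proof.
move=> Xr sX tX stX.
apply: (local_hom_signed (e := fun a => iota (E (a *: X)))
  (P := fun a => `|a *: X| < rho / 2)) => //.
- by move=> a; rewrite scaleNr normrN.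
- by move=> a aX; rewrite scaleNr; exact: exp_opp.
- by move=> a b a0 b0 aX bX abX; exact: exp_add_nonneg.
Qed.

Lemma local_exp_inj X X' : `|X| <= rho / 2 -> `|X'| <= rho / 2 ->
  iota (E X) = iota (E X') -> X = X'.
Proof.
move=> H H' /(congr1 kappa).
rewrite !centered_invK ?local_exp_small // => EE.
have := local_exp_lipschitz H H'; rewrite EE subrr sub0r normrN.
have := normr_ge0 (X - X') => D0 L.
have : `|X - X'| <= 0 by lra.
by rewrite normr_le0 subr_eq0 => /eqP.
Qed.

Lemma local_exp_surj (T : Type) (F : set_system T) {FF : Filter F} (g : T -> G)
    e : 0 < e -> g x @[x --> F] --> 1%g ->
  \forall x \near F, exists2 X, `|X| < e & g x = iota (E X).
Proof.
move=> e0 g1; have k0 : kappa (g x) @[x --> F] --> (0 : 'rV[R]_n).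
  exact: centered_map_cvg.
have gK : \forall x \near F, iota (kappa (g x)) = g x.
  exact: centered_mapK_near.
have rh0 := exp_radius_gt0.
(* [rho / 4] is half the radius [rho / 2] of [local_exp_lipschitz], as [near_identity_surj]
   requires; [e / 4] leaves room for the factor 2 in its conclusion. *)
pose d := Num.min (rho / 4) (e / 4).
have d0 : 0 < d by rewrite lt_min !divr_gt0.
have dr : d <= rho / 4 by rewrite ge_min lexx.
have de : d <= e / 4 by rewrite ge_min lexx orbT.
have small : \forall x \near F, `|kappa (g x)| < d.
  by apply: cvgr_norm_lt k0 _ _; rewrite normr0.
apply: filterS2 gK small => x gx kx.
have [] := @near_identity_surj R n E (rho / 2) (kappa (g x)).
- exact: local_exp_lipschitz.
- exact: local_exp0.
- by lra.
move=> X XE XK; exists X; last by rewrite XK.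
by lra.
Qed.

Lemma exp_cvg0 (T : Type) (F : set_system T) {FF : Filter F} (X : T -> 'rV[R]_n) :
  X t @[t --> F] --> (0 : 'rV[R]_n) -> iota (E (X t)) @[t --> F] --> 1%g.
Proof.
move=> X0; have n0 : `|0 : 'rV[R]_n| < r by rewrite normr0.
have EX : E (X t) @[t --> F] --> (0 : 'rV[R]_n).
  apply: (squeeze_norm (b := fun t => 2 * `|X t|)).
    have : \forall t \near F, `|X t| < rho / 2.
      by apply: cvgr_norm_lt X0 _ _; rewrite normr0; exact: half_radius_pos.
    apply: filterS => t /ltW Xt; rewrite subr0; exact: local_exp_norm.
  rewrite -[X in _ --> X](mulr0 2); apply: cvgMr.
  by rewrite -(@normr0 _ 'rV[R]_n); exact: cvg_norm X0.
rewrite -(centered_inv0 c1).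
exact: cvg_comp _ _ EX (centered_inv_continuous n0).
Qed.

(** For a single factor, [local_exp_approx] says that [E] is the identity up to second order. *)
Lemma local_exp_derive X : is_derive (0 : R) 1 (fun s => E (s *: X)) X.
Proof.
have rh0 := exp_radius_gt0; have re := exp_radius_le.
have X0 := normr_ge0 X.
apply/is_derive_epsP => e e0; rewrite scale0r local_exp0.
have hX : h *: X @[h --> (0 : R)] --> (0 : 'rV[R]_n).
  by rewrite -(scale0r X); apply: cvgZl; exact: cvg_id.
have s1 : \forall h \near (0 : R), `|h *: X| < rho / 2.
  by apply: cvgr_norm_lt hX _ _; rewrite normr0; exact: half_radius_pos.
pose K := 2 * C * `|X| ^+ 2.
have K0 : 0 <= K by rewrite !mulr_ge0 // exprn_ge0.
have s2 : \forall h \near (0 : R), `|h| < e / (K + 1).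
  by apply: nbhs0_lt; rewrite divr_gt0 // ltr_wpDl.
apply: filterS2 s1 s2 => h h1 h2.
have := @local_exp_approx (h *: X) 1; rewrite mul1r scale1r => /(_ (ltW h1)).
rewrite /pw expg1 centered_invK; last by lra.
rewrite addr0 subr0 -[h *: (1 : R)]/(h * 1) mulr1 distrC mul1r => /le_trans; apply.
have := normr_ge0 h => n0.
have : `|h| * (K + 1) < e by rewrite -ltr_pdivlMr // ltr_wpDl.
rewrite normrZ exprMn [`|h| ^+ 2]expr2 => H.
have -> : 2 * C * (`|h| * `|h| * `|X| ^+ 2) = (`|h| * K) * `|h|.
  by rewrite /K; ring.
by rewrite ler_wpM2r //; lra.
Qed.

Lemma exp_exists X : `|X| < rho / 2 -> exists gamma : R -> G,
  [/\ forall s t, gamma (s + t) = (gamma s * gamma t)%g,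
      gamma 1 = iota (E X),
      gamma s @[s --> (0 : R)] --> 1%g &
      is_derive (0 : R) 1 (cmap c \o gamma) X].
Proof.
move=> Xr; pose e (s : R) := iota (E (s *: X)).
have small (s : R) : `|s| <= 1 -> `|s *: X| < rho / 2.
  move=> s1; rewrite normrZ; apply: le_lt_trans Xr.
  by rewrite -[leRHS]mul1r ler_wpM2r.
have eD s t : `|s| < 1 -> `|t| < 1 -> `|s + t| < 1 -> e (s + t) = (e s * e t)%g.
  by move=> /ltW s1 /ltW t1 /ltW st1; apply: exp_add => //; exact: small.
have [gamma [gD gE]] := extend_local_hom ltr01 eD.
have near0 : \forall s \near (0 : R), gamma s = e s.
  have : \forall s \near (0 : R), `|s| < 1.
    exact: nbhs0_lt.
  by apply: filterS => s; exact: gE.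
exists gamma; split=> //.
(* [gamma] is known to agree with [e] only for [|s| < 1], so its value at 1 is computed as the
   square of its value at 1/2. *)
- have h1 : `|2^-1 : R| < 1 by rewrite ger0_norm // invf_lt1 // ltr1n.
  have hh : 2^-1 + 2^-1 = 1 :> R by lra.
  rewrite -{1}hh gD !(gE _ h1) /e -exp_add ?hh ?scale1r //.
    exact: small (ltW h1).
  exact: small (ltW h1).
- have e1 : e s @[s --> (0 : R)] --> 1%g.
    apply: exp_cvg0; rewrite -(scale0r X); apply: cvgZl; exact: cvg_id.
  by apply: cvg_trans e1; apply: near_eq_cvg; apply: filterS near0 => s ->.
- have E1 := local_exp_derive X.
  have E2 : is_derive (0 : R) 1 (fun s => E (s *: X) + cmap c 1%g) X.
    by rewrite -[X in is_derive _ _ _ X]addr0; apply: is_deriveD.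
  have s1 : \forall s \near (0 : R), `|s| < 1 by exact: nbhs0_lt.
  apply: near_eq_is_derive E2; apply: filterS2 near0 s1 => s gs /ltW s1.
  rewrite /= gs /e -{1}(centered_invK (local_exp_small (ltW (small s s1)))).
  by rewrite /centered_map subrK.
Qed.

(** [gamma 1] is the power of exponent [N.+1] of [gamma (1 / N.+1)], and the derivative at 0 says
    that [N.+1] times the coordinates of the latter tend to [X]. *)
Lemma exp_unique gamma X : `|X| < rho / 2 ->
  (forall s t, gamma (s + t) = (gamma s * gamma t)%g) ->
  gamma s @[s --> (0 : R)] --> 1%g ->
  is_derive (0 : R) 1 (cmap c \o gamma) X -> gamma 1 = iota (E X).
Proof.
move=> Xr gD g1 gX.
have h0 : N.+1%:R^-1 @[N --> \oo] --> (0 : R) by exact: cvg_harmonic.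
pose g N := gamma N.+1%:R^-1.
have gN1 : g N @[N --> \oo] --> 1%g by exact: cvg_comp _ _ h0 g1.
have gamma0 : gamma 0 = 1%g.
  by apply: (mulgI (gamma 0)); rewrite -gD addr0 mulg1.
have gM (s : R) N : (gamma s ^+ N)%g = gamma (N%:R * s).
  elim: N => [|N IH]; first by rewrite expg0 mul0r gamma0.
  by rewrite expgSr IH -gD -natr1 mulrDl mul1r.
have gK : \forall N \near \oo, iota (kappa (g N)) = g N.
  exact: centered_mapK_near.
have g0 : kappa (g N) @[N --> \oo] --> (0 : 'rV[R]_n) by exact: centered_map_cvg.
have cst : (g N ^+ N.+1)%g @[N --> \oo] --> gamma 1.
  under eq_fun do rewrite gM mulfV ?pnatr_eq0//.
  exact: cvg_cst.
apply: (limg_unique cst); apply: (exp_of_powers Xr g0 gK).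
apply/cvgrPdist_le => e e0.
have /is_derive_epsP /(_ e e0) H := gX.
have {}H := cvg_near h0 H.
apply: filterS H => N /=.
rewrite addr0 -[_ *: (1 : R)]/(_ * 1) mulr1 gamma0 -/(g N) -/(kappa (g N)) => HN.
have N0 : 0 < N.+1%:R :> R by [].
move: (kappa (g N)) HN => z HN.
have -> : X - N.+1%:R *: z = - (N.+1%:R *: (z - N.+1%:R^-1 *: X)).
  by rewrite scalerBr scalerA mulfV ?gt_eqF // scale1r opprB.
rewrite normrN normrZ gtr0_norm // mulrC -ler_pdivlMr //.
by move: HN; rewrite ger0_norm ?invr_ge0.
Qed.

End LocalExp.

(** * One-parameter subgroups and the global exponential map *)

Section OneParameterSubgroups.
Context {R : realType} {n : nat} {G : lieGroupType R n}.
Context (c : chart G 'rV[R]_n) (c1 : chart_at_identity c).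

(** Regularity is asked at 0 only, since this is what the limit construction provides; smoothness
    follows in [hom_with_velocity_smooth]. *)
Definition hom_with_velocity (gamma : R -> G) (X : 'rV[R]_n) : Prop :=
  [/\ forall s t, gamma (s + t) = (gamma s * gamma t)%g,
      gamma s @[s --> (0 : R)] --> 1%g &
      is_derive (0 : R) 1 (cmap c \o gamma) X].

(** The interface to exp near 0. The radius is such that velocities below it determine endpoints,
    and endpoints determine such velocities. *)
Lemma exp_coordinates : exists (rho : R) (eG : 'rV[R]_n -> G),
  [/\ 0 < rho,
      (forall X, `|X| < rho -> exists2 gamma, hom_with_velocity gamma X &
         gamma 1 = eG X) /\
      (forall gamma X, `|X| < rho -> hom_with_velocity gamma X ->
         gamma 1 = eG X),
      forall X X', `|X| < rho -> `|X'| < rho -> eG X = eG X' -> X = X',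
      forall e, 0 < e -> \forall g \near (1%g : G), exists2 X, `|X| < e & g = eG X &
      eG X @[X --> (0 : 'rV[R]_n)] --> 1%g].
Proof.
have [C [r [C0 r0 Hi Hd [Hl Hr]]]] := local_group_estimates c1.
exists (exp_radius C r / 2), (fun X => centered_inv c (local_exp c X)).
split.
- by rewrite divr_gt0 // exp_radius_gt0.
- split=> [X Xr|gamma X Xr [gD g1 gX]].
    have [gamma [gD ge g1 gX]] := exp_exists c1 C0 r0 Hi Hd Hl Hr Xr.
    by exists gamma.
  exact: (exp_unique c1 C0 r0 Hi Hd Hl Hr Xr gD g1 gX).
- move=> X X' /ltW Xr /ltW X'r.
  exact: (local_exp_inj c1 C0 r0 Hi Hd Hl Hr Xr X'r).
- move=> e e0.
  exact: (local_exp_surj c1 C0 r0 Hi Hd Hl Hr e0 (@cvg_id _ (nbhs (1%g : G)))).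
- exact: (exp_cvg0 c1 C0 r0 Hi Hd Hl Hr (@cvg_id _ (nbhs (0 : 'rV[R]_n)))).
Qed.

Lemma hom0 (gamma : R -> G) :
  (forall s t, gamma (s + t) = (gamma s * gamma t)%g) -> gamma 0 = 1%g.
Proof. by move=> gD; apply: (mulgI (gamma 0)); rewrite -gD addr0 mulg1. Qed.

Lemma homX (gamma : R -> G) s N :
  (forall s t, gamma (s + t) = (gamma s * gamma t)%g) ->
  gamma (N%:R * s) = (gamma s ^+ N)%g.
Proof.
move=> gD; elim: N => [|N IH]; first by rewrite expg0 mul0r hom0.
by rewrite expgSr -IH -gD -natr1 mulrDl mul1r.
Qed.

(** Slowed down by a factor [M], a homomorphism has a small velocity, for which [exp_coordinates]
    determines the endpoint; the power of exponent [M] restores the speed. *)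
Lemma hom_with_velocity_unique gamma gamma' X :
  hom_with_velocity gamma X -> hom_with_velocity gamma' X ->
  gamma 1 = gamma' 1.
Proof.
have [rho [eG [rho0 [_ eU] _ _ _]]] := exp_coordinates.
pose M := (Num.truncn (`|X| / rho)).+1.
have M0 : 0 < M%:R :> R by [].
have HM : `|M%:R^-1 *: X| < rho.
  have /andP[_ H] := Num.Theory.truncn_itv (divr_ge0 (normr_ge0 X) (ltW rho0)).
  rewrite normrZ ger0_norm ?invr_ge0// mulrC ltr_pdivrMr//.
  by rewrite mulrC -ltr_pdivrMr.
have key g : hom_with_velocity g X -> g 1 = (eG (M%:R^-1 *: X) ^+ M)%g.
  move=> [gD g1 gX].
  have E : g 1 = g (M%:R * (M%:R^-1 * 1)) by rewrite mulr1 mulfV ?gt_eqF.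
  rewrite E homX //; congr (_ ^+ _)%g.
  apply: (eU (fun s => g (M%:R^-1 * s))) => //; split.
  - by move=> s t; rewrite mulrDr gD.
  - have : M%:R^-1 * s @[s --> (0 : R)] --> (0 : R).
      by rewrite -[X in _ --> X](mulr0 M%:R^-1); apply: cvgMr; exact: cvg_id.
    by move=> H; exact: cvg_comp _ _ H g1.
  - have /(is_derive_scale_dir M%:R^-1) /is_derive_epsP H := gX.
    apply/is_derive_epsP => e e0; apply: filterS (H e e0) => h /=.
    rewrite !addr0 -![_ *: (1 : R)]/(_ * 1) !mulr1 mulr0.
    by rewrite -[h *: M%:R^-1]/(h * M%:R^-1) mulrC.
by move=> /key -> /key ->.
Qed.

Lemma hom_continuous (gamma : R -> G) :
  (forall s t, gamma (s + t) = (gamma s * gamma t)%g) ->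
  gamma s @[s --> (0 : R)] --> 1%g -> continuous gamma.
Proof.
move=> gD g1 t.
have E : gamma = fun s => (gamma (s - t) * gamma t)%g.
  by apply/funext => s; rewrite -gD subrK.
rewrite /continuous_at {1}E -[X in _ --> X]mul1g.
have H : s - t @[s --> t] --> (0 : R).
  by rewrite -(subrr t); apply: cvgB; [exact: cvg_id|exact: cvg_cst].
by apply: mulg_cvg; [exact: cvg_comp _ _ H g1|exact: cvg_cst].
Qed.

Lemma chart_near1 (T : Type) (F : set_system T) {FF : Filter F} (g : T -> G) :
  g x @[x --> F] --> 1%g -> \forall x \near F, cdom c (g x).
Proof.
have [oc _ _ _ _] := lie_chart c1.1.
by move=> g1; apply: cvg_near g1 _; exact: open_nbhs_nbhs (conj oc c1.2).
Qed.

(** Since [gamma (h + t) = gamma h * gamma t], the velocity at [t] is the right-invariant field of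
    [X] at [gamma t], here written in an arbitrary chart [d]. *)
Lemma hom_derive_in_chart (d : chart G 'rV[R]_n) gamma X t : lie_atlas d ->
  hom_with_velocity gamma X -> cdom d (gamma t) ->
  is_derive t 1 (cmap d \o gamma)
    ('D_(X, 0) (mul_in_charts c d d) (cmap c 1%g, cmap d (gamma t))).
Proof.
move=> Ad [gD g1 gX] gtd; have [Ac c1d] := c1.
have [_ _ cK _ _] := lie_chart Ac; have [_ _ dK _ _] := lie_chart Ad.
pose M := mul_in_charts c d d; pose O := mul_source c d d.
pose z := cmap d (gamma t).
have Opz : O (cmap c 1%g, z).
  by apply: mul_sourceP => //; [exists 1%g|exists (gamma t)|rewrite cK // dK // mul1g].
have oO : open O by exact: open_mul_source.
have HM : Cn_on 1 O M by exact: mul_in_charts_smooth.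
have fd : differentiable (fun y => M (y, z)) ((cmap c \o gamma) 0).
  rewrite /= hom0 //.
  exact: (C1_differentiable (open_pairl z oO) (Cn_on_pairl z HM) Opz).
have := is_derive_comp_curve gX fd.
rewrite (derive_pairl M) /= hom0 // => /is_derive_epsP H.
apply/is_derive_epsP => e e0.
apply: filterS2 (H e e0) (chart_near1 g1) => h + hc.
rewrite -[h *: (1 : R)]/(h * 1) mulr1 addr0 /= /M /mul_in_charts /= hom0 //.
by rewrite cK // cK // dK // mul1g gD.
Qed.

(** In each chart the curve is an integral curve of the right-invariant field of [X], whose
    coordinates are a partial derivative of the group law and hence smooth. *)
Lemma hom_with_velocity_smooth gamma X : hom_with_velocity gamma X ->
  one_parameter_subgroup gamma.
Proof.
move=> gX; have [gD g1 _] := gX; have gc := hom_continuous gD g1.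
split=> //; split=> // _ d -> Ad.
have [Ac c1d] := c1; have [od oid dK _ _] := lie_chart Ad.
have [_ _ cK _ _] := lie_chart Ac.
have -> : cmap (Chart setT id id : chart R R) @`
    (cdom (Chart setT id id : chart R R) `&` gamma @^-1` cdom d) =
    gamma @^-1` cdom d.
  by apply/seteqP; split=> [_ [t [_ td] <-]|t td] //; exists t.
pose V (z : 'rV[R]_n) : 'rV[R]_n :=
  'D_(X, 0) (mul_in_charts c d d) (cmap c 1%g, z).
apply: (@smooth_on_integral_curve _ _ (gamma @^-1` cdom d) (cimg d)
  (cmap d \o gamma) V).
- by apply: open_comp => // t _; exact: gc.
- exact: oid.
- by move=> t td; exists (gamma t).
- move=> k; have HM : Cn_on k.+1 (mul_source c d d) (mul_in_charts c d d).
    exact: mul_in_charts_smooth.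
  apply: Cn_on_subset (Cn_on_pairr (cmap c 1%g) (Cn_on_derive (X, 0) HM)).
  move=> z zd; apply: mul_sourceP => //; first by exists 1%g.
  by rewrite cK // mul1g; have [] := cimgP (lie_chart Ad) zd.
- by move=> t td; exact: hom_derive_in_chart.
Qed.

Lemma one_parameter_subgroup_velocity gamma : one_parameter_subgroup gamma ->
  hom_with_velocity gamma ('D_1 (cmap c \o gamma) 0).
Proof.
move=> [[gc gs] gD]; have [Ac c1d] := c1; have g0 := hom0 gD.
split=> //; first by rewrite -g0; exact: gc.
apply: derivableP.
have := gs (Chart setT id id) c erefl Ac 1%N => H.
apply: (Cn_on_derivable H).
by exists 0 => //; split => //=; rewrite g0.
Qed.

(** [lie_exp] is a choice among candidates: [hom_with_velocity_smooth] makes [gamma 1] one of them,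
    and [hom_with_velocity_unique] makes it the only one. *)
Lemma lie_expE gamma X : hom_with_velocity gamma X -> lie_exp c X = gamma 1.
Proof.
move=> gX; rewrite /lie_exp; case: xgetP => [g gE [gamma' [P' DX ->]]|].
  apply: (hom_with_velocity_unique (X := X)) => //.
  by rewrite -DX; exact: one_parameter_subgroup_velocity.
move=> /(_ (gamma 1)) []; exists gamma; split=> //.
  exact: hom_with_velocity_smooth gX.
by case: gX => _ _ [].
Qed.

End OneParameterSubgroups.

(** * Flows and one-parameter subgroups *)

Section FlowDynamics.
Context {R : realType} {n : nat} {G : lieGroupType R n}.
Context (c : chart G 'rV[R]_n) (c1 : chart_at_identity c).

Lemma endo1 (f : G -> G) : (forall g h, f (g * h)%g = (f g * f h)%g) -> f 1%g = 1%g.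
Proof. by move=> fM; apply: (mulgI (f 1%g)); rewrite -fM !mulg1. Qed.

Lemma hom_with_velocity_endo (f : G -> G) gamma X :
  (forall g h, f (g * h)%g = (f g * f h)%g) -> continuous f ->
  differentiable (cmap c \o f \o cinv c) (cmap c 1%g) ->
  hom_with_velocity c gamma X ->
  hom_with_velocity c (f \o gamma) (diff_at_identity c f X).
Proof.
move=> fM fc fd [gD g1 gX]; have [_ _ cK _ _] := lie_chart c1.1.
split; first by move=> s t /=; rewrite gD fM.
  by rewrite -(endo1 fM); exact: cvg_comp _ _ g1 (fc 1%g).
have fd' : differentiable (cmap c \o f \o cinv c) ((cmap c \o gamma) 0).
  by rewrite /= hom0.
have := is_derive_comp_curve gX fd'; rewrite /= hom0 // => H.
have H1 : \forall s \near (0 : R), cdom c (gamma s) by exact: (chart_near1 c1 g1).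
apply: near_eq_is_derive H.
by apply: filterS H1 => s sc; rewrite /= cK.
Qed.

Lemma flow_chart_differentiable (phi : R -> G -> G) t :
  flow_of_automorphisms phi ->
  continuous (phi t) /\
  differentiable (cmap c \o phi t \o cinv c) (cmap c 1%g).
Proof.
move=> [[pc ps] p0 pD pM]; have [Ac c1d] := c1.
have [oc oic cK _ _] := lie_chart Ac; split.
  move=> g; have H := pc (t, g).
  exact: cvg_comp _ _ (cvg_pair (@cvg_cst _ t _ (nbhs g) _) cvg_id) H.
pose i := Chart setT id id : chart R R.
have ic : is_chart i.
  split=> //; try by move=> x _; exact: cvg_id.
    exact: openT.
  have -> : cimg i = setT by apply/seteqP; split=> x _ //; exists x.
  exact: openT.
pose O := chart_source (prod_chart i c) c (fun p : R * G => phi p.1 p.2).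
have oO : open O.
  by apply: open_chart_source => //; apply: is_chart_prod => //; exact: lie_chart.
pose F (q : R * 'rV[R]_n) : 'rV[R]_n := cmap c (phi q.1 (cinv c q.2)).
have HF : Cn_on 1 O F.
  by apply: (ps (prod_chart i c) c _ Ac 1%N); exists i, c.
have Otp : O (t, cmap c 1%g).
  by exists (t, 1%g) => //; split=> //=; rewrite (endo1 (pM t)).
exact: (C1_differentiable (open_pairr t oO) (Cn_on_pairr t HF) Otp).
Qed.

Context (psi : R -> G -> G) (L : R -> 'rV[R]_n -> 'rV[R]_n).
Context (psi0 : forall g, psi 0 g = g).
Context (psiD : forall s t g, psi (s + t) g = psi s (psi t g)).
Context (psiM : forall t g h, psi t (g * h)%g = (psi t g * psi t h)%g).
Context (psiL : forall t gamma X, hom_with_velocity c gamma X ->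
  hom_with_velocity c (psi t \o gamma) (L t X)).
Context (L0 : forall X, L 0 X = X).
Context (LD : forall s t X, L (s + t) X = L s (L t X)).

(** [X] may be large: only [L t X], for large [t], has to lie where [eG] gives the endpoint. *)
Lemma flow_exp_cvg gamma X : hom_with_velocity c gamma X ->
  L t X @[t --> +oo] --> (0 : 'rV[R]_n) ->
  psi t (gamma 1) @[t --> +oo] --> (1%g : G).
Proof.
move=> gX LX; have [rho [eG [rho0 [_ eU] _ _ e0]]] := exp_coordinates c1.
have H : eG (L t X) @[t --> +oo] --> (1%g : G) by exact: cvg_comp _ _ LX e0.
have small : \forall t \near +oo, `|L t X| < rho.
  by apply: cvgr_norm_lt LX _ _; rewrite normr0.
apply: cvg_trans H; apply: near_eq_cvg; apply: filterS small => t tX.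
by rewrite -(eU _ _ tX (psiL t gX)).
Qed.

(** The danger is that logarithms along the orbit jump. After [T] they are shorter than [rho / 2]; a
    time step of at most [s0] at most doubles lengths, so [L s X] is shorter than [rho], where [eG]
    is injective, and must equal the logarithm found at the later time. It is thus again shorter
    than [rho / 2], and the next step starts from the same bound. *)
Lemma stable_point_exp g s0 : 0 < s0 ->
  (forall s X, 0 <= s <= s0 -> `|L s X| <= 2 * `|X|) ->
  psi t g @[t --> +oo] --> (1%g : G) ->
  exists gamma X, [/\ hom_with_velocity c gamma X, gamma 1 = g &
    L t X @[t --> +oo] --> (0 : 'rV[R]_n)].
Proof.
move=> s00 Ls g1.
have [rho [eG [rho0 [eE eU] einj esurj _]]] := exp_coordinates c1.
have r2 : 0 < rho / 2 by rewrite divr_gt0.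
have log e : 0 < e -> exists T : R, forall t, T < t ->
    exists2 X, `|X| < e & psi t g = eG X.
  by move=> /esurj H; have [T [_ HT]] := cvg_near g1 H; exists T.
have [T HT] := log _ r2.
pose t0 := T + 1.
have [Y Yr Ye] : exists2 Y, `|Y| < rho / 2 & psi t0 g = eG Y.
  by apply: HT; rewrite ltrDl.
have Yr' : `|Y| < rho by lra.
have step s X : 0 <= s <= s0 -> forall t, T < t -> `|X| < rho / 2 ->
    psi t g = eG X -> `|L s X| < rho / 2 /\ psi (s + t) g = eG (L s X).
  move=> s01 t Tt Xr Xt.
  have LX := Ls s X s01.
  have [Z Zr Zt] : exists2 Z, `|Z| < rho / 2 & psi (s + t) g = eG Z.
    by apply: HT; have /andP[] := s01; lra.
  have [gam gamX gam1] : exists2 gamma, hom_with_velocity c gamma X & gamma 1 = eG X.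
    by apply: eE; lra.
  have E : psi (s + t) g = eG (L s X).
    by rewrite psiD Xt -gam1; apply: (eU _ _ _ (psiL s gamX)); lra.
  have -> : L s X = Z by apply: einj; [lra|lra|rewrite -E].
  by [].
have steps s k : 0 <= s <= s0 ->
    `|L (k%:R * s) Y| < rho / 2 /\ psi (k%:R * s + t0) g = eG (L (k%:R * s) Y).
  move=> s01; have /andP[s_ge0 _] := s01.
  elim: k => [|k [IH1 IH2]]; first by rewrite mul0r L0 add0r.
  rewrite -natr1 mulrDl mul1r [_ + s]addrC LD -addrA; apply: step => //.
  by have : 0 <= k%:R * s; [rewrite mulr_ge0|rewrite /t0; lra].
have all s : 0 <= s ->
    `|L s Y| < rho / 2 /\ psi (s + t0) g = eG (L s Y).
  (* Any [s >= 0] is cut into [k] equal steps of length at most [s0]. *)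
  move=> s_ge0; pose k := (Num.truncn (s / s0)).+1.
  have k0 : 0 < k%:R :> R by [].
  have -> : s = k%:R * (s / k%:R) by rewrite mulrC divfK // gt_eqF.
  apply: steps; rewrite divr_ge0 //= ler_pdivrMr // mulrC -ler_pdivrMr //.
  by have /andP[_ /ltW] := Num.Theory.truncn_itv (divr_ge0 s_ge0 (ltW s00)).
have [gam gamX gam1] := eE Y Yr'.
exists (psi (- t0) \o gam), (L (- t0) Y); split.
- exact: psiL.
- by rewrite /= gam1 -Ye -psiD addNr psi0.
apply/cvgrPdist_lt => e e0.
(* Below [e] for the limit, below [rho / 2] so that injectivity identifies the logarithm with
   [L (t - t0) Y]. *)
have er0 : 0 < Num.min e (rho / 2) by rewrite lt_min e0.
have [T' HT'] := log _ er0.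
exists (Num.max T' t0); split; first exact: num_real.
move=> t; rewrite gt_max => /andP[tT' tt0].
have [X] := HT' t tT'; rewrite lt_min => /andP[Xe Xr] tX.
have st : 0 <= t - t0 by rewrite subr_ge0 ltW.
have [H1 H2] := all _ st; rewrite subrK in H2.
rewrite sub0r normrN -LD.
have -> : L (t - t0) Y = X by apply: einj; [lra|lra|rewrite -H2 -tX].
by [].
Qed.

End FlowDynamics.

(** * Matrix exponentials and the Jordan decomposition *)

Section MatrixExponential.
Context {R : realType}.

Lemma is_cvg_pseries_fact (a : nat -> R) A B x : 0 <= A -> 0 <= B ->
  (forall k, `|a k| <= A * B ^+ k) ->
  cvgn (pseries (fun k => (k`!%:R)^-1 * a k) x).
Proof.
move=> A0 B0 H; apply: normed_cvg.
have C : cvgn (series (A *: exp_coeff (B * `|x|))).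
  by apply: is_cvg_seriesZ; exact: is_cvg_series_exp_coeff.
apply: (series_le_cvg _ _ _ C) => k /=; first exact: normr_ge0.
  by rewrite /exp_coeff /= mulr_ge0 // mulr_ge0 ?invr_ge0 // exprn_ge0 // mulr_ge0.
rewrite /exp_coeff /= !fctE /= normrM normrM [`|_^-1|]ger0_norm ?invr_ge0 //.
rewrite normrX exprMn.
apply: (@le_trans _ _ ((k`!%:R)^-1 * (A * B ^+ k) * `|x| ^+ k)).
  by rewrite ler_wpM2r ?exprn_ge0 // ler_wpM2l ?invr_ge0.
by rewrite le_eqVlt -[A *: _]/(A * _); apply/orP; left; apply/eqP; ring.
Qed.

Lemma mx_exp_entry_bound n (D : 'M[R]_n) k i j :
  `|(D ^+ k) i j| <= (\sum_a \sum_b `|D a b|) ^+ k.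
Proof.
elim: k i j => [|k IH] i j.
  by rewrite !expr0 [1]/(1%:M) mxE; case: eqP => _; rewrite ?normr1 ?normr0.
rewrite !exprS mxE; apply: le_trans (ler_norm_sum _ _ _) _.
apply: (@le_trans _ _ (\sum_l `|D i l| * (\sum_a \sum_b `|D a b|) ^+ k)).
  by apply: ler_sum => l _; rewrite normrM ler_wpM2l.
rewrite -mulr_suml ler_wpM2r //.
  by rewrite exprn_ge0 //; apply: sumr_ge0 => a _; apply: sumr_ge0.
rewrite [leRHS](bigD1 i) //= lerDl; apply: sumr_ge0 => a _; exact: sumr_ge0.
Qed.

Lemma exprZmx n (D : 'M[R]_n) (t : R) k : (t *: D) ^+ k = t ^+ k *: D ^+ k.
Proof.
elim: k => [|k IH]; first by rewrite !expr0 scale1r.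
by rewrite !exprS IH -!mulmxE -scalemxAl -scalemxAr scalerA.
Qed.

Lemma mx_cvg (T : Type) (F : set_system T) {FF : Filter F} m n
    (f : T -> 'M[R]_(m, n)) (l : 'M[R]_(m, n)) :
  (forall i j, f x i j @[x --> F] --> l i j) -> f x @[x --> F] --> l.
Proof.
move=> H; apply/cvgrPdist_le => e e0.
have : \forall x \near F, forall ij, `|l ij.1 ij.2 - f x ij.1 ij.2| <= e.
  by apply: filter_forall => -[i j]; move/cvgrPdist_le : (H i j); exact.
apply: filterS => x Hx; rewrite [leLHS]/Num.Def.normr/= mx_normrE.
by apply: bigmax_le => [|ij _]; [exact: ltW|rewrite !mxE].
Qed.

Let coef n (D : 'M[R]_n) i j (k : nat) : R := (k`!%:R)^-1 * (D ^+ k) i j.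

Let coef_diffs (a : nat -> R) :
  pseries_diffs (fun k => (k`!%:R)^-1 * a k) = (fun k => (k`!%:R)^-1 * a k.+1).
Proof.
apply/funext => k; rewrite /pseries_diffs factS natrM invfM mulrA mulrA.
by rewrite mulfV ?mul1r // pnatr_eq0.
Qed.

Let coef_cvg n (D : 'M[R]_n) i j m x :
  cvgn (pseries (fun k => (k`!%:R)^-1 * (D ^+ (k + m)) i j) x).
Proof.
set B := \sum_a \sum_b `|D a b|.
have B0 : 0 <= B by apply: sumr_ge0 => a _; exact: sumr_ge0.
apply: (@is_cvg_pseries_fact _ (B ^+ m) B) => //; first exact: exprn_ge0.
by move=> k; rewrite -exprD addnC; exact: mx_exp_entry_bound.
Qed.

Let expmx_series n (D : 'M[R]_n) (t : R) :
  series (fun k : nat => (k`!%:R : R)^-1 *: (t *: D) ^+ k) @ \oo -->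
  (\matrix_(i, j) limn (pseries (coef D i j) t) : 'M[R]_n).
Proof.
apply: mx_cvg => i j; rewrite mxE.
rewrite (_ : (fun N => _) = pseries (coef D i j) t).
  by have := @coef_cvg n D i j 0 t; under eq_fun do rewrite addn0.
apply/funext => N; rewrite /pseries /series /= summxE; apply: eq_bigr => k _.
by rewrite exprZmx !mxE /coef; ring.
Qed.

Lemma expmx_entry n (D : 'M[R]_n) (t : R) i j :
  expmx (t *: D) i j = limn (pseries (coef D i j) t).
Proof.
by rewrite /expmx (cvg_lim _ (@expmx_series n D t)) // mxE.
Qed.

Let expmx_entry_derive_aux n (D : 'M[R]_n) (t : R) i j :
  is_derive t (1 : R) (fun s => expmx (s *: D) i j)
    (limn (pseries (fun k => (k`!%:R)^-1 * (D ^+ k.+1) i j) t)).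
Proof.
under eq_fun do rewrite expmx_entry.
have := @pseries_snd_diffs R (coef D i j) (`|t| + 1) t.
(* Termwise differentiation asks for convergence of the series and of its first two formal
   derivatives at a point beyond [|t|], here [|t| + 1]. *)
rewrite /coef coef_diffs // coef_diffs //; apply.
- by have := @coef_cvg n D i j 0 (`|t| + 1); under eq_fun do rewrite addn0.
- by have := @coef_cvg n D i j 1 (`|t| + 1); under eq_fun do rewrite addn1.
- by have := @coef_cvg n D i j 2 (`|t| + 1); under eq_fun do rewrite addn2.
- by rewrite [ltRHS]ger0_norm ?addr_ge0 // ltrDl.
Qed.

Lemma expmx_derive_entry n (D : 'M[R]_n) (t : R) i j :
  is_derive t (1 : R) (fun s => expmx (s *: D) i j) ((expmx (t *: D) *m D) i j).
Proof.
apply: is_derive_eq (expmx_entry_derive_aux _ _ _ _) _.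
rewrite mxE; apply: cvg_lim => //.
rewrite (_ : pseries _ _ = fun N => \sum_(l < n) pseries (coef D i l) t N * D l j).
  apply: (@cvg_big _ _ +%R) => [|l _]; first exact: add_continuous.
  rewrite expmx_entry; apply: cvgMl.
  by have := @coef_cvg n D i l 0 t; under eq_fun do rewrite addn0.
apply/funext => N; rewrite /pseries /series /=.
under [RHS]eq_bigr do rewrite mulr_suml.
rewrite exchange_big /=; apply: eq_bigr => k _.
rewrite exprSr mxE mulr_sumr mulr_suml; apply: eq_bigr => l _.
by rewrite /coef; ring.
Qed.

Lemma expmx_cvg n (D : 'M[R]_n) (t : R) :
  series (fun k : nat => (k`!%:R : R)^-1 *: (t *: D) ^+ k) @ \oo --> expmx (t *: D).
Proof. by rewrite /expmx (cvg_lim _ (@expmx_series n D t)) //; exact: expmx_series. Qed.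

Lemma cvg_mulmxr (T : Type) (F : set_system T) {FF : Filter F} m n p
    (f : T -> 'M[R]_(m, n)) (l : 'M[R]_(m, n)) (A : 'M[R]_(n, p)) :
  f x @[x --> F] --> l -> f x *m A @[x --> F] --> l *m A.
Proof.
move=> fl; apply: mx_cvg => i j; rewrite mxE.
under eq_fun do rewrite mxE.
apply: (@cvg_big _ _ +%R) => [|k _]; first exact: add_continuous.
by apply: cvgMl; exact: cvg_comp _ _ fl (@coord_continuous _ _ _ i k l).
Qed.

Lemma cvg_mulmxl (T : Type) (F : set_system T) {FF : Filter F} m n p
    (f : T -> 'M[R]_(n, p)) (l : 'M[R]_(n, p)) (A : 'M[R]_(m, n)) :
  f x @[x --> F] --> l -> A *m f x @[x --> F] --> A *m l.
Proof.
move=> fl; apply: mx_cvg => i j; rewrite mxE.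
under eq_fun do rewrite mxE.
apply: (@cvg_big _ _ +%R) => [|k _]; first exact: add_continuous.
by apply: cvgMr; exact: cvg_comp _ _ fl (@coord_continuous _ _ _ k j l).
Qed.

Lemma comm_expmx n (A D : 'M[R]_n) t : comm_mx A D ->
  comm_mx A (expmx (t *: D)).
Proof.
move=> AD; pose S := series (fun k : nat => (k`!%:R : R)^-1 *: (t *: D) ^+ k).
have H : S N @[N --> \oo] --> expmx (t *: D) by exact: expmx_cvg.
have AS N : A *m S N = S N *m A.
  rewrite /S /series /= mulmx_sumr mulmx_suml; apply: eq_bigr => k _.
  rewrite -scalemxAr -scalemxAl exprZmx -scalemxAr -scalemxAl; congr (_ *: (_ *: _)).
  elim: k => [|k IH]; first by rewrite expr0 -[1]/(1%:M) mulmx1 mul1mx.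
  by rewrite exprS -mulmxE mulmxA AD -mulmxA IH mulmxA.
have H1 : A *m S N @[N --> \oo] --> A *m expmx (t *: D) by exact: cvg_mulmxl.
have H2 : A *m S N @[N --> \oo] --> expmx (t *: D) *m A.
  by under eq_fun do rewrite AS; exact: cvg_mulmxr.
exact: (cvg_unique (@norm_hausdorff _ _) H1 H2).
Qed.

Lemma is_derive_mxP m n (M : R -> 'M[R]_(m, n)) (M' : 'M[R]_(m, n)) (t : R) :
  is_derive t (1 : R) M M' <-> forall i j, is_derive t (1 : R) (fun s => M s i j) (M' i j).
Proof.
split=> [[Md <-] i j|H].
  split; first by have /derivable_mxP := Md; exact.
  by rewrite derive_mx // mxE.
have Md : derivable M t 1 by apply/derivable_mxP => i j; case: (H i j).
split=> //; rewrite derive_mx //; apply/matrixP => i j; rewrite mxE.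
by case: (H i j).
Qed.

Lemma expmx_derive n (D : 'M[R]_n) (t : R) :
  is_derive t (1 : R) (fun s => expmx (s *: D)) (expmx (t *: D) *m D).
Proof. by apply/is_derive_mxP => i j; exact: expmx_derive_entry. Qed.

Lemma is_derive_mulmx m n p (M : R -> 'M[R]_(m, n)) (N : R -> 'M[R]_(n, p))
    M' N' (t : R) : is_derive t (1 : R) M M' -> is_derive t (1 : R) N N' ->
  is_derive t (1 : R) (fun s => M s *m N s) (M' *m N t + M t *m N').
Proof.
move=> /is_derive_mxP HM /is_derive_mxP HN; apply/is_derive_mxP => i j.
have H (k : 'I_n) : is_derive t (1 : R) (fun s => M s i k * N s k j)
    (M t i k * N' k j + N t k j * M' i k).
  exact: (@is_deriveM _ _ (fun s => M s i k) (fun s => N s k j)).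
have -> : (fun s => (M s *m N s) i j) = \sum_(k < n) (fun s => M s i k * N s k j).
  by apply/funext => s; rewrite mxE fct_sumE.
apply: is_derive_eq; rewrite !mxE -big_split /=; apply: eq_bigr => k _.
by rewrite addrC [N t k j * _]mulrC.
Qed.

Lemma mx_derive0_cst m n (M : R -> 'M[R]_(m, n)) (s t : R) :
  (forall t : R, is_derive t (1 : R) M 0) -> M s = M t.
Proof.
move=> H; apply/matrixP => i j.
apply: (@is_derive_0_is_cst R (fun s => M s i j)) => x.
by have /is_derive_mxP /(_ i j) := H x; rewrite mxE.
Qed.

Lemma expmx0 n : expmx (0 : 'M[R]_n) = 1%:M.
Proof.
rewrite /expmx; apply: cvg_lim => //.
have K : \forall N \near \oo,
    series (fun k : nat => (k`!%:R : R)^-1 *: (0 : 'M[R]_n) ^+ k) N = 1%:M.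
  exists 1%N => // -[//|N] _ /=.
  rewrite /series /= big_nat_recl //= fact0 invr1 scale1r expr0.
  by rewrite big1 ?addr0 // => k _; rewrite exprS mul0r scaler0.
apply: cvg_trans (@cvg_cst _ (1%:M : 'M[R]_n) _ \oo _).
by apply: near_eq_cvg; apply: filterS K => N ->.
Qed.

Lemma is_derive_reparam m n (M : R -> 'M[R]_(m, n)) (M' : 'M[R]_(m, n)) (a t : R) :
  is_derive (a * t) (1 : R) M M' -> is_derive t (1 : R) (fun s => M (a * s)) (a *: M').
Proof.
move=> /(is_derive_scale_dir a) /is_derive_epsP H.
apply/is_derive_epsP => e e0; apply: filterS (H e e0) => h.
rewrite -[a *: (1 : R)]/(a * 1) -[h *: (1 : R)]/(h * 1) !mulr1.
by rewrite -[h *: a]/(h * a) mulrDr [a * h]mulrC.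
Qed.

Lemma is_derive_shiftl m n (M : R -> 'M[R]_(m, n)) (M' : 'M[R]_(m, n)) (a t : R) :
  is_derive (a + t) (1 : R) M M' -> is_derive t (1 : R) (fun s => M (a + s)) M'.
Proof.
move=> /is_derive_epsP H.
apply/is_derive_epsP => e e0; apply: filterS (H e e0) => h.
by rewrite addrCA.
Qed.

Lemma expmx_opp_derive n (D : 'M[R]_n) (s : R) :
  is_derive s (1 : R) (fun s => expmx (- s *: D)) (- (D *m expmx (- s *: D))).
Proof.
have := @is_derive_reparam _ _ (fun s => expmx (s *: D)) _ (-1) s
  (expmx_derive D (-1 * s)).
rewrite scaleN1r mulN1r; under eq_fun do rewrite mulN1r.
by have -> : D *m expmx (- s *: D) = expmx (- s *: D) *m D by exact: comm_expmx.
Qed.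

Lemma expmx_ode_conserved m n (v : R -> 'M[R]_(m, n)) (D : 'M[R]_n) (t : R) :
  (forall t : R, is_derive t (1 : R) v (v t *m D)) ->
  v t *m expmx (- t *: D) = v 0.
Proof.
move=> Hv; transitivity (v 0 *m expmx (- 0 *: D)).
  apply: (@mx_derive0_cst _ _ (fun s => v s *m expmx (- s *: D))) => s.
  apply: is_derive_eq (is_derive_mulmx (Hv s) (expmx_opp_derive D s)) _.
  by rewrite mulmxN mulmxA subrr.
by rewrite oppr0 scale0r expmx0 mulmx1.
Qed.

Lemma expmxN n (D : 'M[R]_n) (t : R) : expmx (t *: D) *m expmx (- t *: D) = 1%:M.
Proof.
have := @expmx_ode_conserved _ _ (fun s => expmx (s *: D)) D t (expmx_derive D).
by rewrite scale0r expmx0.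
Qed.

(** The working characterization of the exponential: the group law, commuting sums, eigenvectors and
    rotations are each handled by exhibiting a solution of this equation. *)
Lemma expmx_ode_unique m n (v : R -> 'M[R]_(m, n)) (D : 'M[R]_n) (t : R) :
  (forall t : R, is_derive t (1 : R) v (v t *m D)) -> v t = v 0 *m expmx (t *: D).
Proof.
move=> Hv; have := expmxN D (- t); rewrite opprK => E.
by rewrite -(expmx_ode_conserved t Hv) -mulmxA E mulmx1.
Qed.

Lemma expmxD n (D : 'M[R]_n) s t :
  expmx ((s + t) *: D) = expmx (s *: D) *m expmx (t *: D).
Proof.
have := @expmx_ode_unique _ _ (fun u => expmx ((s + u) *: D)) D t.
rewrite addr0; apply => u.
exact: (is_derive_shiftl (M := fun u => expmx (u *: D)) (expmx_derive D (s + u))).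
Qed.

Lemma expmx_add_comm n (A B : 'M[R]_n) t : comm_mx A B ->
  expmx (t *: (A + B)) = expmx (t *: A) *m expmx (t *: B).
Proof.
move=> AB.
have := @expmx_ode_unique _ _ (fun u => expmx (u *: A) *m expmx (u *: B)) (A + B) t.
rewrite !scale0r !expmx0 !mul1mx => H; apply/esym/H => u.
apply: is_derive_eq (is_derive_mulmx (expmx_derive A u) (expmx_derive B u)) _.
have C : comm_mx A (expmx (u *: B)) by exact: comm_expmx.
by rewrite mulmxDr -!mulmxA C.
Qed.

End MatrixExponential.

(** * Asymptotics of the linear flow *)

Section JordanDynamics.
Context {R : realType} {n : nat}.
Implicit Types (D E H N A : 'M[R]_n) (X a b : 'rV[R]_n) (l t : R).

Lemma expR_neg_cvg l : l < 0 -> expR (l * t) @[t --> +oo] --> (0 : R).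
Proof.
move=> l0; apply/cvgrPdist_lt => e e0.
have /cvgrPdist_lt /(_ e e0) [M [_ HM]] := @cvgr_expR R.
have l0' : 0 < - l by rewrite oppr_gt0.
exists (M / - l); split; first exact: num_real.
move=> t Mt; have : M < - l * t by rewrite mulrC -ltr_pdivrMr.
by move=> /HM; rewrite mulNr opprK.
Qed.

Lemma eigen_expmx H a l t : a *m H = l *: a ->
  a *m expmx (t *: H) = expR (l * t) *: a.
Proof.
move=> aH.
have := @expmx_ode_unique R 1 n (fun s => expR (l * s) *: a) H t.
rewrite mulr0 expR0 scale1r => K; apply/esym/K => s.
apply/is_derive_mxP => i j.
have d1 : is_derive s (1 : R) (fun s => l * s) l.
  apply/is_derive_epsP => e e0; apply: filterE => h.
  have -> : l * (h *: (1 : R) + s) - l * s - h *: l = 0.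
    by rewrite -[h *: (1 : R)]/(h * 1) -[h *: l]/(h * l); ring.
  by rewrite normr0 mulr_ge0 // ltW.
have := is_derive1_comp (@is_derive_expR R (l * s)) d1 => d2.
have -> : (fun s => (expR (l * s) *: a) i j) = (expR \o (fun s => l * s)) * cst (a i j).
  by apply/funext => u; rewrite !mxE.
apply: is_derive_eq; rewrite -scalemxAl aH !mxE scaler0 add0r.
by rewrite -[X in X = _]/(a i j * (expR (l * s) * l)); ring.
Qed.

(** The exponential series stops before [k], and [(e t)^j / j!] is at most [expR (e * t)]:
    polynomial growth is slower than any exponential rate [e]. *)
Lemma nilpotent_expmx_growth N k X e : N ^+ k = 0 -> 0 < e ->
  exists C, 0 <= C /\
    forall t, 0 <= t -> `|X *m expmx (t *: N)| <= C * expR (e * t).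
Proof.
move=> Nk e0.
have expN t : expmx (t *: N) = \sum_(0 <= j < k) (j`!%:R)^-1 *: (t *: N) ^+ j.
  rewrite /expmx; apply: cvg_lim => //.
  apply: cvg_trans (@cvg_cst _ _ _ \oo _); apply: near_eq_cvg.
  exists k => // m /= km; rewrite /series /=.
  rewrite [RHS](big_cat_nat (n := k)) //= [X in _ = _ + X]big_nat_cond.
  rewrite [X in _ = _ + X]big1 ?addr0 // => j /andP[/andP[kj _] _].
  by rewrite exprZmx -(subnKC kj) [N ^+ _]exprD Nk mul0r !scaler0.
exists (\sum_(0 <= j < k) (e ^- j * `|X *m N ^+ j|)); split.
  by apply: sumr_ge0 => j _; rewrite mulr_ge0 // invr_ge0 exprn_ge0 // ltW.
move=> t t0; rewrite expN mulmx_sumr mulr_suml.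
apply: le_trans (ler_norm_sum _ _ _) _; apply: ler_sum => j _.
rewrite -scalemxAr exprZmx -scalemxAr scalerA normrZ ger0_norm; last first.
  by rewrite mulr_ge0 ?invr_ge0 // exprn_ge0.
rewrite [leRHS]mulrAC ler_wpM2r //.
have et : (e * t) ^+ j / j`!%:R <= expR (e * t).
  have et0 : 0 <= e * t by rewrite mulr_ge0 // ltW.
  case: j => [|j]; first by rewrite expr0 fact0 divr1 -expR0 ler_expR.
  by have := expR_ge1Dxn j et0; lra.
rewrite -ler_pdivrMl ?invr_gt0 ?exprn_gt0 // invrK; apply: le_trans et.
by rewrite exprMn mulrCA [leLHS]mulrC.
Qed.

(** The decomposition in real terms: a bounded elliptic flow, for both signs of time, in place of
    imaginary eigenvalues, and one list of real eigenvalues valid for all vectors. Changing the sign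
    of the four matrices visibly preserves it. *)
Definition jordan_dynamics D E H N : Prop :=
  [/\ D = E + H + N,
      [/\ comm_mx E H, comm_mx E N & comm_mx H N],
      exists M, forall t X, `|X *m expmx (t *: E)| <= M * `|X|,
      exists k, N ^+ k = 0 &
      exists2 ls : seq R, uniq ls & forall X, exists a : R -> 'rV[R]_n,
        X = \sum_(l <- ls) a l /\ forall l, a l *m H = l *: a l].

Lemma jordan_dynamics_opp D E H N : jordan_dynamics D E H N ->
  jordan_dynamics (- D) (- E) (- H) (- N).
Proof.
move=> [-> [EH EN HN] [M HM] [k Nk] [ls uls Hls]]; split.
- by rewrite !opprD.
- by split; rewrite /comm_mx !mulmxN !mulNmx ?EH ?EN ?HN.
- by exists M => t X; rewrite scalerN -scaleNr.
- exists k; have -> : - N = -1 *: N by rewrite scaleN1r.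
  by rewrite exprZmx Nk scaler0.
- exists (map -%R ls); first by rewrite map_inj_uniq //; exact: oppr_inj.
  move=> X; have [a [XE aH]] := Hls X; exists (fun l => a (- l)); split.
    by rewrite big_map XE; apply: eq_bigr => l _; rewrite opprK.
  by move=> l; rewrite mulmxN aH scaleNr opprK.
Qed.

Section Dyn.
Context (D E H N : 'M[R]_n) (dyn : jordan_dynamics D E H N).

Lemma eigen_flow a l t : a *m H = l *: a ->
  a *m expmx (t *: D) = expR (l * t) *: (a *m expmx (t *: N) *m expmx (t *: E)).
Proof.
have [-> [EH EN HN] _ _ _] := dyn; move=> aH.
have -> : E + H + N = H + (N + E) by rewrite [E + H]addrC -addrA [E + N]addrC.
have c1 : comm_mx H (N + E) by rewrite /comm_mx mulmxDl mulmxDr HN EH.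
rewrite expmx_add_comm // mulmxA (eigen_expmx t aH) -scalemxAl.
by rewrite expmx_add_comm ?mulmxA //; exact/esym.
Qed.

Lemma neg_eigen_flow_cvg a l : l < 0 -> a *m H = l *: a ->
  a *m expmx (t *: D) @[t --> +oo] --> (0 : 'rV[R]_n).
Proof.
move=> l0 aH; have [_ _ [M HM] [k Nk] _] := dyn.
(* Half of the decay rate absorbs the growth due to [N]; the other half remains. *)
have e0 : 0 < - (l / 2) by lra.
have [C [C0 HC]] := nilpotent_expmx_growth a Nk e0.
apply: (squeeze_norm (b := fun t => `|M| * C * expR (l / 2 * t))); last first.
  rewrite -[X in _ --> X](mulr0 (`|M| * C)); apply: cvgMr.
  by apply: expR_neg_cvg; lra.
exists 0; split => // t t0; rewrite subr0 (eigen_flow t aH) normrZ.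
rewrite ger0_norm ?expR_ge0 //.
have -> : expR (l / 2 * t) = expR (l * t) * expR (- (l / 2) * t).
  by rewrite -expRD; congr expR; field.
rewrite [leRHS]mulrCA ler_wpM2l ?expR_ge0 // -mulrA.
apply: le_trans (HM _ _) _; apply: (@le_trans _ _ (`|M| * `|a *m expmx (t *: N)|)).
  by rewrite ler_wpM2r // ler_norm.
by rewrite ler_wpM2l //; apply: HC; exact: ltW.
Qed.

Lemma neg_eigensum_flow_cvg X : neg_eigensum H X ->
  X *m expmx (t *: D) @[t --> +oo] --> (0 : 'rV[R]_n).
Proof.
move=> [s [+ ]]; elim: s X => [|l s IH] X.
  move=> _; rewrite big_nil submx0 => /eqP ->.
  by under eq_fun do rewrite mul0mx; exact: cvg_cst.
move=> /= /andP[l0 s0]; rewrite big_cons => /sub_addsmxP[[u1 u2] /= XE].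
have H1 : (u1 *m eigenspace H l) *m H = l *: (u1 *m eigenspace H l).
  by apply/eigenspaceP; rewrite submxMl.
have c1 := neg_eigen_flow_cvg l0 H1.
have c2 := IH _ s0 (submxMl u2 _).
rewrite XE -[X in _ --> X](addr0 0).
under eq_fun do rewrite mulmxDl.
exact: cvgD.
Qed.

(* Induction on the least [k] with [a N^k = 0]: by induction [a N = 0], and
   then [|a e^{tD}| >= |a e^{tE}|] does not tend to 0. *)
Lemma nonneg_eigen_flow_cvg0 a l : 0 <= l -> a *m H = l *: a ->
  a *m expmx (t *: D) @[t --> +oo] --> (0 : 'rV[R]_n) -> a = 0.
Proof.
have [DE [EH EN HN] [M HM] [k Nk] _] := dyn; move=> l0.
have aNk : a *m N ^+ k = 0 by rewrite Nk mulmx0.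
have DN : comm_mx N D.
  by rewrite DE /comm_mx !mulmxDl !mulmxDr -EN -HN.
elim: k a aNk {Nk} => [|k IH] a aNk aH a_cvg.
  by rewrite -aNk expr0 -[1]/(1%:M) mulmx1.
have aN : a *m N = 0.
  apply: IH.
  - by rewrite -mulmxA -[N *m _]/(N * N ^+ k) -exprS.
  - by rewrite -mulmxA -HN mulmxA aH scalemxAl.
  - under eq_fun do rewrite -mulmxA (comm_expmx _ DN) mulmxA.
    by rewrite -(mul0mx _ N); exact: cvg_mulmxr.
have aexpN t : a *m expmx (t *: N) = a.
  have := @eigen_expmx N a 0 t; rewrite mul0r expR0 scale1r scale0r; exact.
have bound : \forall t \near +oo, `|a| <= `|M| * `|a *m expmx (t *: D)|.
  exists 0; split => // t t0; rewrite (eigen_flow t aH) aexpN normrZ.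
  rewrite ger0_norm ?expR_ge0 //.
  have e1 : 1 <= expR (l * t) by rewrite -expR0 ler_expR mulr_ge0 // ltW.
  (* The elliptic bound also holds at time [- t], so [e^{tE}] cannot shrink [a] by more than a
     constant factor. *)
  have -> : `|a| = `|a *m expmx (t *: E) *m expmx (- t *: E)|.
    by rewrite -mulmxA expmxN mulmx1.
  apply: le_trans (HM _ _) _.
  apply: (@le_trans _ _ (`|M| * `|a *m expmx (t *: E)|)).
    by rewrite ler_wpM2r // ler_norm.
  by rewrite ler_wpM2l // -[leLHS]mul1r ler_wpM2r.
apply/eqP; rewrite -normr_le0; apply/ler_addgt0Pr => e e0; rewrite add0r.
have M0 : 0 < `|M| + 1 by rewrite ltr_wpDl.
have : \forall t \near +oo, `|a *m expmx (t *: D)| < e / (`|M| + 1).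
  by apply: cvgr_norm_lt a_cvg _ _; rewrite normr0 divr_gt0.
case=> T1 [_ H1]; case: bound => T2 [_ H2].
pose t := Num.max T1 T2 + 1.
have m1 : T1 < t by rewrite /t ltr_pwDr // le_max lexx.
have m2 : T2 < t by rewrite /t ltr_pwDr // le_max lexx orbT.
have K1 := H1 t m1; have K2 := H2 t m2; rewrite /= in K1 K2.
rewrite ltr_pdivlMr // in K1; apply: le_trans K2 _.
have := normr_ge0 (a *m expmx (t *: D)); lra.
Qed.

Lemma eigen_prod a l (r : seq R) : a *m H = l *: a ->
  a *m (\prod_(m <- r) (H - m%:M)) = (\prod_(m <- r) (l - m)) *: a.
Proof.
move=> aH; elim: r => [|m r IH].
  by rewrite !big_nil -[1]/(1%:M) mulmx1 scale1r.
rewrite !big_cons -mulmxE mulmxA mulmxBr aH mul_mx_scalar -scalerBl.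
by rewrite -scalemxAl IH scalerA.
Qed.

(* The component of [X] of eigenvalue [l] is a multiple of [X Q], where [Q] is a
   polynomial in [H] and so commutes with the flow. *)
Lemma flow_cvg_neg_eigensum X :
  X *m expmx (t *: D) @[t --> +oo] --> (0 : 'rV[R]_n) -> neg_eigensum H X.
Proof.
move=> Xc; have [DE [EH EN HN] _ _ [ls uls Hls]] := dyn.
have [a [XE aH]] := Hls X.
have HD : comm_mx H D by rewrite DE /comm_mx !mulmxDl !mulmxDr EH HN.
have a0 l : l \in ls -> 0 <= l -> a l = 0.
  move=> lls l0; pose r := rem l ls.
  (* As in Lagrange interpolation, [Q] kills every component except that of [l], which it multiplies
     by [q]. *)
  pose Q := \prod_(m <- r) (H - m%:M); pose q := \prod_(m <- r) (l - m).
  have q0 : q != 0.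
    rewrite prodf_seq_neq0; apply/allP => m; rewrite mem_rem_uniq // !inE /=.
    by rewrite subr_eq0 eq_sym => /andP[].
  have XQ : X *m Q = q *: a l.
    rewrite XE mulmx_suml (big_rem l) //= (eigen_prod _ (aH l)).
    rewrite -/q [X in _ + X]big_seq [X in _ + X]big1 ?addr0 // => m mr.
    rewrite (eigen_prod _ (aH m)).
    by rewrite (big_rem m) //= subrr mul0r scale0r.
  have QD : comm_mx Q D.
    rewrite /Q; elim: (r) => [|m r' IH].
      by rewrite big_nil /comm_mx -[1]/(1%:M) mul1mx mulmx1.
    rewrite big_cons -mulmxE /comm_mx -mulmxA IH !mulmxA; congr (_ *m _).
    by rewrite mulmxBl mulmxBr HD scalar_mxC.
  apply: (nonneg_eigen_flow_cvg0 l0 (aH l)).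
  have -> : a l = q^-1 *: (X *m Q) by rewrite XQ scalerA mulVf // scale1r.
  have -> : (fun t => q^-1 *: (X *m Q) *m expmx (t *: D)) =
            (fun t => X *m expmx (t *: D) *m (q^-1 *: Q)).
    apply/funext => t; rewrite -scalemxAl -scalemxAr -!mulmxA; congr (_ *: (_ *m _)).
    exact: comm_expmx.
  by rewrite -(mul0mx _ (q^-1 *: Q)); exact: cvg_mulmxr.
exists [seq l <- ls | l < 0]; split; first by rewrite filter_all.
have -> : X = \sum_(l <- [seq l <- ls | l < 0]) a l.
  rewrite big_filter XE big_seq [RHS]big_seq_cond.
  rewrite (bigID (fun l => l < 0)) /= [X in _ + X]big1 ?addr0 //.
  by move=> l /andP[lls]; rewrite -leNgt => l0; exact: a0.
elim: [seq _ <- _ | _] => [|l s IH]; first by rewrite !big_nil sub0mx.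
rewrite !big_cons; apply: addmx_sub_adds => //.
by apply/eigenspaceP.
Qed.

End Dyn.
End JordanDynamics.

(** * From complex eigenvalues to real dynamics *)

Section JordanDecomposition.
Context {R : realType} {n : nat}.
Implicit Types (D E H N A : 'M[R]_n) (X u v : 'rV[R]_n) (t : R).

Lemma eigenspace_sum_decompose (F : fieldType) m (B : 'M[F]_m) (rs : seq F)
    (Y : 'rV[F]_m) : uniq rs -> (Y <= \sum_(r <- rs) eigenspace B r)%MS ->
  exists z : F -> 'rV[F]_m, Y = \sum_(r <- rs) z r /\
    forall r, z r *m B = r *: z r.
Proof.
elim: rs Y => [|r rs IH] Y /=.
  move=> _; rewrite big_nil submx0 => /eqP ->; exists (fun=> 0).
  by rewrite big_nil; split => // r; rewrite mul0mx scaler0.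
move=> /andP[rrs urs]; rewrite big_cons => /sub_addsmxP[[u1 u2] /= YE].
have [z [zE zB]] := IH _ urs (submxMl u2 _).
exists (fun x => if x == r then u1 *m eigenspace B r else z x); split.
  rewrite YE zE big_cons eqxx; congr (_ + _).
  rewrite !big_seq; apply: eq_bigr => x xrs.
  by case: eqP => // xr; rewrite -xr xrs in rrs.
move=> x; case: eqP => // ->.
by apply/eigenspaceP; rewrite submxMl.
Qed.

(** [u r] and [v r] are the real and imaginary parts of the complex eigencomponents of [X]; as [X]
    is real, the real parts sum to it. The list may contain numbers that are not eigenvalues; their
    components vanish, which is the last alternative. *)
Lemma semisimple_decompose A : semisimple A ->
  exists2 rs : seq R[i], uniq rs & forall X, exists u v : R[i] -> 'rV[R]_n,
    X = \sum_(r <- rs) u r /\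
    forall r, [/\ u r *m A = complex.Re r *: u r - complex.Im r *: v r,
                  v r *m A = complex.Re r *: v r + complex.Im r *: u r &
                  eigenvalue (complexify A) r \/ u r = 0 /\ v r = 0].
Proof.
move=> /diagonalizablePeigen[rs urs rsE]; exists rs => // X.
have XS : (map_mx (real_complex R) X <= \sum_(r <- rs) eigenspace (complexify A) r)%MS.
  by rewrite rsE submx1.
have [z [XE zA]] := eigenspace_sum_decompose urs XS.
exists (fun r => map_mx (@complex.Re R) (z r)), (fun r => map_mx (@complex.Im R) (z r)).
have ReD (x y : R[i]) : complex.Re (x + y) = complex.Re x + complex.Re y.
  by case: x y => [? ?] [? ?].
have ImD (x y : R[i]) : complex.Im (x + y) = complex.Im x + complex.Im y.
  by case: x y => [? ?] [? ?].
have ReM (x y : R[i]) : complex.Re (x * y) =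
    complex.Re x * complex.Re y - complex.Im x * complex.Im y.
  by case: x y => [? ?] [? ?].
have ImM (x y : R[i]) : complex.Im (x * y) =
    complex.Re x * complex.Im y + complex.Im x * complex.Re y.
  by case: x y => [? ?] [? ?].
split.
  apply/rowP => i; rewrite summxE.
  transitivity (complex.Re (map_mx (real_complex R) X 0 i)); first by rewrite mxE.
  rewrite XE summxE (big_morph (@complex.Re R) ReD (erefl : @complex.Re R 0 = 0)).
  by apply: eq_bigr => r _; rewrite mxE.
have ReA r i : complex.Re ((z r *m complexify A) 0 i) =
    (map_mx (@complex.Re R) (z r) *m A) 0 i.
  rewrite !mxE (big_morph (@complex.Re R) ReD (erefl : @complex.Re R 0 = 0)); apply: eq_bigr => k _.
  by rewrite !mxE ReM /= mulr0 subr0.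
have ImA r i : complex.Im ((z r *m complexify A) 0 i) =
    (map_mx (@complex.Im R) (z r) *m A) 0 i.
  rewrite !mxE (big_morph (@complex.Im R) ImD (erefl : @complex.Im R 0 = 0)); apply: eq_bigr => k _.
  by rewrite !mxE ImM /= mulr0 add0r.
move=> r; split.
- by apply/rowP => i; rewrite -ReA zA !mxE ReM.
- by apply/rowP => i; rewrite -ImA zA !mxE ImM.
- have [z0|z0] := eqVneq (z r) 0; last by left; apply/eigenvalueP; exists (z r).
  by right; rewrite z0; split; apply/rowP => i; rewrite !mxE.
Qed.

Lemma rotation_expmx E u v b t : u *m E = - b *: v -> v *m E = b *: u ->
  u *m expmx (t *: E) = cos (b * t) *: u - sin (b * t) *: v.
Proof.
move=> uE vE.
have := @expmx_ode_unique R 1 n (fun s => cos (b * s) *: u - sin (b * s) *: v) E t.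
rewrite mulr0 cos0 sin0 scale1r scale0r subr0 => K; apply/esym/K => s.
apply/is_derive_mxP => i j.
have d1 : is_derive s (1 : R) (fun s => b * s) b.
  apply/is_derive_epsP => e e0; apply: filterE => h.
  have -> : b * (h *: (1 : R) + s) - b * s - h *: b = 0.
    by rewrite -[h *: (1 : R)]/(h * 1) -[h *: b]/(h * b); ring.
  by rewrite normr0 mulr_ge0 // ltW.
have dc := is_derive1_comp (@is_derive_cos R (b * s)) d1.
have ds := is_derive1_comp (@is_derive_sin R (b * s)) d1.
have -> : (fun s => (cos (b * s) *: u - sin (b * s) *: v) i j) =
    (cos \o (fun s => b * s)) * cst (u i j) - (sin \o (fun s => b * s)) * cst (v i j).
  by apply/funext => x; rewrite !mxE.
apply: is_derive_eq; rewrite mulmxBl -!scalemxAl uE vE !mxE !scaler0 !add0r.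
rewrite -[X in X - _]/(u i j * (- sin (b * s) * b)).
by rewrite -[X in _ - X]/(v i j * (cos (b * s) * b)); ring.
Qed.

Lemma elliptic_bounded E : elliptic E ->
  exists M, forall t X, `|X *m expmx (t *: E)| <= M * `|X|.
Proof.
move=> [/semisimple_decompose[rs urs H] Re0].
have B X : exists C, forall t, `|X *m expmx (t *: E)| <= C.
  have [u [v [-> uv]]] := H X.
  exists (\sum_(r <- rs) (`|u r| + `|v r|)) => t.
  rewrite mulmx_suml; apply: le_trans (ler_norm_sum _ _ _) _; apply: ler_sum => r _.
  have [uE vE eig] := uv r.
  have uE' : u r *m E = - complex.Im r *: v r.
    by case: eig => [/Re0 r0|[u0 v0]]; rewrite uE ?r0 ?u0 ?v0
         ?scale0r ?scaler0 ?subr0 ?sub0r ?oppr0 ?scaleNr.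
  have vE' : v r *m E = complex.Im r *: u r.
    by case: eig => [/Re0 r0|[u0 v0]]; rewrite vE ?r0 ?u0 ?v0 ?scale0r ?scaler0 ?add0r.
  rewrite (rotation_expmx t uE' vE'); apply: le_trans (ler_normB _ _) _.
  rewrite !normrZ lerD // -[leRHS]mul1r ler_wpM2r //.
    by rewrite ler_norml cos_geN1 cos_le1.
  by rewrite ler_norml sin_geN1 sin_le1.
(* The bound obtained so far depends on the vector; one bound per basis vector makes it uniform. *)
pose C i := sval (cid (B (delta_mx 0 i))).
have HC i t : `|(delta_mx 0 i : 'rV[R]_n) *m expmx (t *: E)| <= C i.
  exact: (svalP (cid (B (delta_mx 0 i)))).
have C0 i : 0 <= C i by apply: le_trans (HC i 0).
pose K := \sum_i C i.
exists (n%:R * K) => t X.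
have -> : X *m expmx (t *: E) = \sum_(i < n) X 0 i *: (delta_mx 0 i *m expmx (t *: E)).
  by rewrite {1}[X]row_sum_delta mulmx_suml; apply: eq_bigr => i _; rewrite -scalemxAl.
apply: row_comb_norm_le => [|i]; first by apply: sumr_ge0.
by apply: le_trans (HC i t) _; rewrite /K (bigD1 i) //= lerDl sumr_ge0.
Qed.

(** Components with the same real part are merged, since the complex list may contain non-real
    numbers; these are not eigenvalues and contribute 0. *)
Lemma hyperbolic_decompose H : hyperbolic H ->
  exists2 ls : seq R, uniq ls & forall X, exists a : R -> 'rV[R]_n,
    X = \sum_(l <- ls) a l /\ forall l, a l *m H = l *: a l.
Proof.
move=> [/semisimple_decompose[rs urs HX] Im0].
exists (undup [seq complex.Re r | r <- rs]); first exact: undup_uniq.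
move=> X; have [u [v [XE uv]]] := HX X.
exists (fun l => \sum_(r <- rs | complex.Re r == l) u r); split.
  rewrite (exchange_big_dep predT) //= XE big_seq [RHS]big_seq.
  apply: eq_bigr => r rrs; under eq_bigl do rewrite eq_sym.
  rewrite -big_filter filter_pred1_uniq ?undup_uniq ?mem_undup ?map_f //.
  by rewrite big_seq1.
move=> l; rewrite mulmx_suml scaler_sumr; apply: eq_bigr => r /eqP <-.
have [uH _ [/Im0 r0|[u0 v0]]] := uv r; rewrite uH ?r0 ?u0 ?v0.
  by rewrite scale0r subr0.
by rewrite !scaler0 subr0.
Qed.

Lemma jordan_decomposition_dynamics D E H N :
  jordan_decomposition D E H N -> jordan_dynamics D E H N.
Proof.
by move=> [DE [ellE hypH nilN] comms]; split=> //;
  [exact: elliptic_bounded|exact: hyperbolic_decompose].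
Qed.

End JordanDecomposition.

(** Supplies the step length for [stable_point_exp]. Near time 0 each basis vector moves by at most
    [1 / (n + 1)], so [X] moves by at most [|X|]. *)
Lemma near0_expmx_le (R : realType) n (D : 'M[R]_n) : exists2 s0 : R, 0 < s0 &
  forall s (X : 'rV[R]_n), 0 <= s <= s0 -> `|X *m expmx (s *: D)| <= 2 * `|X|.
Proof.
have c0 : expmx (s *: D) @[s --> (0 : R)] --> (1%:M : 'M[R]_n).
  have [d _] := expmx_derive D 0.
  have := differentiable_continuous (proj1 (derivable1_diffP _ _) d).
  rewrite -(@expmx0 R n) -[X in expmx X](scale0r D); exact.
have e0 : 0 < n.+1%:R^-1 :> R by rewrite invr_gt0.
have near0 (i : 'I_n) : \forall s \near (0 : R),
    `|(delta_mx 0 i : 'rV[R]_n) *m expmx (s *: D) - delta_mx 0 i| <= n.+1%:R^-1.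
  have : (delta_mx 0 i : 'rV[R]_n) *m expmx (s *: D) @[s --> (0 : R)] --> (delta_mx 0 i : 'rV[R]_n).
    by rewrite -[X in _ --> X]mulmx1; exact: cvg_mulmxl.
  move=> /cvgrPdist_le /(_ _ e0); apply: filterS => s.
  by rewrite distrC.
have [r /= r0 Hr] := (proj1 (nbhs_ballP _ _) (filter_forall (nbhs_filter (0 : R)) near0)).
exists (r / 2); first by rewrite divr_gt0.
move=> s X /andP[s0 sr].
have {}Hr : forall i : 'I_n,
    `|(delta_mx 0 i : 'rV[R]_n) *m expmx (s *: D) - delta_mx 0 i| <= n.+1%:R^-1.
  by apply: Hr; rewrite /ball /= sub0r normrN ger0_norm //; lra.
have -> : X *m expmx (s *: D) = X + \sum_(i < n) X 0 i *:
    ((delta_mx 0 i : 'rV[R]_n) *m expmx (s *: D) - delta_mx 0 i).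
  under eq_bigr do rewrite scalerBr.
  rewrite big_split /= sumrN -row_sum_delta addrCA subrr addr0.
  by rewrite {1}[X]row_sum_delta mulmx_suml; apply: eq_bigr => i _; rewrite -scalemxAl.
apply: le_trans (ler_normD _ _) _.
rewrite mulrDl mul1r lerD2l; apply: le_trans (row_comb_norm_le _ (ltW e0) Hr) _.
rewrite -[leRHS]mul1r ler_wpM2r // ler_pdivrMr // mul1r ler_nat.
exact: leqnSn.
Qed.

(** * The stable manifold *)

Section StableManifold.
Context {R : realType} {n : nat} {G : lieGroupType R n}.
Context (c : chart G 'rV[R]_n) (c1 : chart_at_identity c).
Context (psi : R -> G -> G) (D E H N : 'M[R]_n).
Context (psi0 : forall g, psi 0 g = g).
Context (psiD : forall s t g, psi (s + t) g = psi s (psi t g)).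
Context (psiM : forall t g h, psi t (g * h)%g = (psi t g * psi t h)%g).
Context (psi_smooth : forall t, continuous (psi t) /\
  differentiable (cmap c \o psi t \o cinv c) (cmap c 1%g)).
Context (psi_diff : forall t X, diff_at_identity c (psi t) X = X *m expmx (t *: D)).
Context (dyn : jordan_dynamics D E H N).

Lemma exp_neg_eigensum_stable : lie_exp c @` neg_eigensum H = stable_manifold psi.
Proof.
pose L t (X : 'rV[R]_n) := X *m expmx (t *: D).
have psiL t gamma X : hom_with_velocity c gamma X ->
    hom_with_velocity c (psi t \o gamma) (L t X).
  have [pc pd] := psi_smooth t.
  by rewrite /L -psi_diff; exact: hom_with_velocity_endo.
have L0 X : L 0 X = X by rewrite /L scale0r expmx0 mulmx1.
have LD s t X : L (s + t) X = L s (L t X) by rewrite /L addrC expmxD mulmxA.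
apply/seteqP; split=> [_ [X negX <-]|g gs].
  have LX : L t X @[t --> +oo] --> (0 : 'rV[R]_n) by exact: neg_eigensum_flow_cvg dyn _ negX.
  rewrite /stable_manifold /=.
  rewrite /lie_exp; case: xgetP => [g _ [gamma [P DX ->]]|_].
    apply: (flow_exp_cvg c1 psiL (X := X)) LX.
    by rewrite -DX; exact: one_parameter_subgroup_velocity.
  (* The default value 1 of [lie_exp] is fixed by the flow, so this inclusion calls for no existence
     statement. *)
  under eq_fun do rewrite (endo1 (psiM _)).
  exact: cvg_cst.
have [s0 s00 Ls] := near0_expmx_le D.
have [gamma [X [gX <- LX]]] := stable_point_exp c1 psi0 psiD psiL L0 LD s00 Ls gs.
exists X; last exact: lie_expE.
exact: flow_cvg_neg_eigensum dyn _ LX.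
Qed.

End StableManifold.

Lemma pos_eigensumE (R : realType) n (H : 'M[R]_n) :
  pos_eigensum H = neg_eigensum (- H).
Proof.
have eigN (K : 'M[R]_n) a : (eigenspace K a <= eigenspace (- K) (- a))%MS.
  by apply/eigenspaceP; rewrite mulmxN scaleNr; congr (- _); apply/eigenspaceP.
have sumN (K : 'M[R]_n) s : (\sum_(a <- s) eigenspace K a <=
    \sum_(a <- map -%R s) eigenspace (- K) a)%MS.
  elim: s => [|a s IH]; first by rewrite !big_nil.
  by rewrite /= !big_cons addsmxS.
apply/seteqP; split=> X [s [s0 Xs]]; exists (map -%R s); split.
- by rewrite all_map; apply: sub_all s0 => a /=; rewrite oppr_lt0.
- exact: submx_trans Xs (sumN _ _).
- by rewrite all_map; apply: sub_all s0 => a /=; rewrite oppr_gt0.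
- by apply: submx_trans Xs _; rewrite -{2}[H]opprK; exact: sumN.
Qed.

Theorem theorem3p4 (R : realType) (n : nat) (G : lieGroupType R n)
    (phi : R -> G -> G) (c : chart G 'rV[R]_n) (D DE DH DN : 'M[R]_n)
    (Gconnected : connected [set: G])
    (phi_flow : flow_of_automorphisms phi)
    (c_at_e : chart_at_identity c)
    (phiD : associated_derivation phi c D)
    (D_dec : jordan_decomposition D DE DH DN) :
  Gminus c DH = stable_manifold phi /\ Gplus c DH = unstable_manifold phi.
Proof.
have [_ phi0 phiA phiM] := phi_flow; have [_ phiE] := phiD.
have dyn := jordan_decomposition_dynamics D_dec.
split.
  by apply: (exp_neg_eigensum_stable c_at_e phi0 phiA phiM _ phiE dyn) => t;
    exact: flow_chart_differentiable.
rewrite /Gplus pos_eigensumE.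
rewrite (@exp_neg_eigensum_stable _ _ _ _ c_at_e (fun t => phi (- t))
  (- D) (- DE) (- DH) (- DN)).
- by apply/seteqP; split=> g gs; apply/(cvgNy_compNP (phi^~ g)).
- by move=> g; rewrite oppr0.
- by move=> s t g; rewrite opprD.
- by move=> t; exact: phiM.
- by move=> t; exact: flow_chart_differentiable.
- by move=> t X; rewrite phiE scalerN scaleNr.
- exact: jordan_dynamics_opp.
Qed.
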